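(* The Bass stable rank of the ring $\mathscr{H}^\infty$ of bounded Dirichlet series is infinite.
   Context: Let $\mathbb{N}=\{1,2,3,\dots\}$ and $\mathbb{C}_{>0}=\{s\in\mathbb{C}:\operatorname{Re}(s)>0\}$. $\mathscr{H}^\infty$ denotes the set of Dirichlet series $f(s)=\sum_{n=1}^\infty \frac{a_n}{n^s}$, where $(a_n)_{n\in\mathbb{N}}$ is a sequence of complex numbers, such that $f$ is holomorphic and bounded in $\mathbb{C}_{>0}$ (i.e. the bounded holomorphic functions $f$ on $\mathbb{C}_{>0}$ that are represented by a Dirichlet series converging in some half-plane $\operatorname{Re}(s)>\sigma_0$; by a theorem of Bohr the series then converges in all of $\mathbb{C}_{>0}$). With pointwise operations and the norm $\|f\|_\infty=\sup_{s\in\mathbb{C}_{>0}}|f(s)|$, $\mathscr{H}^\infty$ is a unital commutative complex Banach algebra. Bass stable rank: Let $R$ be a commutative ring with identity element $1$. An element $(a_1,\dots,a_n)\in R^n$ is unimodular if there exist $b_1,\dots,b_n\in R$ such that $b_1a_1+\cdots+b_na_n=1$. The set of all unimodular elements of $R^n$ is denoted $U_n(R)$. An element $(a_1,\dots,a_{n+1})\in U_{n+1}(R)$ is reducible if there exists $(x_1,\dots,x_n)\in R^n$ such that $(a_1+x_1a_{n+1},\dots,a_n+x_na_{n+1})\in U_n(R)$. The Bass stable rank of $R$ is the least integer $n\in\mathbb{N}$ for which every $a\in U_{n+1}(R)$ is reducible; if there is no such integer $n$, the Bass stable rank of $R$ is infinite. *)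

(* Defs.v *)
From HB Require Import structures.
From mathcomp Require Import all_boot all_order all_algebra.
From mathcomp Require Import complex ring lra zify.
From mathcomp Require Import all_classical all_reals all_analysis.
Set Implicit Arguments.
Unset Strict Implicit.
Unset Printing Implicit Defensive.
Import Order.TTheory GRing.Theory Num.Theory numFieldNormedType.Exports.
Local Open Scope classical_set_scope.
Local Open Scope ring_scope.

Section BassStableRank.
Variable A : comPzRingType.

Definition unimodular n (a : 'I_n -> A) : Prop :=
  exists b : 'I_n -> A, \sum_(i < n) b i * a i = 1.

Definition reducible n (a : 'I_n.+1 -> A) : Prop :=
  exists x : 'I_n -> A,
    unimodular (fun i : 'I_n => a (widen_ord (leqnSn n) i) + x i * a ord_max).

Definition unimodular_reducible n : Prop :=
  forall a : 'I_n.+1 -> A, unimodular a -> reducible a.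

(* [None] stands for an infinite Bass stable rank. *)
Definition bass_stable_rank : option nat :=
  if pselect (exists n, `[< (0 < n)%N /\ unimodular_reducible n >])
    is left ex then Some (ex_minn ex) else None.

Lemma bass_stable_rank_infiniteP :
  bass_stable_rank = None <-> forall n, (0 < n)%N -> ~ unimodular_reducible n.
Proof.
rewrite /bass_stable_rank; case: pselect => [ex|nex]; split=> //.
  by have [n /asboolP[n0 An]] := ex; move=> /(_ n n0).
by move=> _ n n0 An; apply: nex; exists n; apply/asboolP.
Qed.

End BassStableRank.

Section BoundedDirichletSeries.
Variable R : realType.

(* The alias [^o] carries the normed topology of the complex field. *)
Local Notation C := (R[i]^o).

Definition halfplane : set C := [set s | 0 < complex.Re s].

Definition cexp (z : C) : C :=
  Complex (expR (complex.Re z) * cos (complex.Im z))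
          (expR (complex.Re z) * sin (complex.Im z)).

(* [natcpow n s] is n^s; only used for n >= 1. *)
Definition natcpow (n : nat) (s : C) : C := cexp (s * Complex (ln n%:R) 0).

Definition dirichlet_sum (a : nat -> C) (s : C) : nat -> C :=
  fun N => \sum_(1 <= n < N.+1) a n / natcpow n s.

(* Complex differentiability at each point of the half-plane; the values of  *)
(* the extension of f by 0 outside the (open) half-plane are irrelevant.     *)
Definition holomorphic_halfplane (f : halfplane -> C) : Prop :=
  forall s : C, halfplane s -> derivable ('valL_(0 : C) f : C -> C) s 1.

Definition represented_by_dirichlet (f : halfplane -> C) : Prop :=
  exists (a : nat -> C) (sigma0 : R), forall s : halfplane,
    sigma0 < complex.Re (val s) ->
    dirichlet_sum a (val s) @ \oo --> (f s : C).

Definition Hinfty : {pred halfplane -> C} := fun f =>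
  `[< [/\ holomorphic_halfplane f, bounded_fun f
        & represented_by_dirichlet f] >].

Lemma normC_complex (x y : R) :
  `|Complex x y : C| = Complex (Num.sqrt (x ^+ 2 + y ^+ 2)) 0.
Proof. by []. Qed.

Lemma Re_le_norm (z : C) : Complex (complex.Re z) 0 <= `|z|.
Proof.
case: z => x y; rewrite normC_complex lecE /= eqxx /=.
apply: le_trans (ler_norm x) _.
by rewrite -sqrtr_sqr ler_wsqrtr// lerDl sqr_ge0.
Qed.

Lemma halfplane_nbhs (s : C) : halfplane s -> nbhs s halfplane.
Proof.
move=> s0; apply/nbhs_ballP; exists (Complex (complex.Re s) 0) => /=.
  by rewrite ltcE /= eqxx.
move=> w; rewrite /ball /= => sw.
have := le_lt_trans (Re_le_norm (s - w)) sw.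
rewrite ltcE /= => /andP[_]; rewrite /halfplane /=.
case: s s0 sw => s1 s2; case: w => w1 w2 /= _ _.
by rewrite ltrBlDr ltrDl.
Qed.

Lemma cexpD (z w : C) : cexp (z + w) = cexp z * cexp w.
Proof.
case: z => z1 z2; case: w => w1 w2; rewrite /cexp.
rewrite -[_ + _]/(Complex (z1 + w1) (z2 + w2)) /=.
rewrite -[RHS]/(Complex _ _) expRD cosD sinD; congr Complex; ring.
Qed.

Lemma norm_cexp (z : C) : `|cexp z| = Complex (expR (complex.Re z)) 0.
Proof.
rewrite normC_complex !exprMn -mulrDr cos2Dsin2 mulr1 sqrtr_sqr.
by rewrite ger0_norm ?expR_ge0.
Qed.

Lemma cexp_neq0 (z : C) : cexp z != 0.
Proof.
by rewrite -normr_eq0 norm_cexp eq_complex /= negb_and gt_eqF ?expR_gt0.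
Qed.

Lemma natcpow_neq0 n (s : C) : natcpow n s != 0.
Proof. exact: cexp_neq0. Qed.

Lemma natcpow1 (s : C) : natcpow 1 s = 1.
Proof.
rewrite /natcpow ln1 (_ : Complex 0 0 = 0)// mulr0 /cexp /= expR0 cos0 sin0.
by rewrite mulr1 mulr0.
Qed.

Lemma natcpowM m n (s : C) : (0 < m)%N -> (0 < n)%N ->
  natcpow (m * n) s = natcpow m s * natcpow n s.
Proof.
move=> m0 n0; rewrite /natcpow -cexpD -mulrDr natrM lnM ?posrE ?ltr0n//.
by congr (cexp (s * _)); rewrite -[RHS]/(Complex _ _) addr0.
Qed.

Lemma norm_natcpow n (s : C) :
  `|natcpow n s| = Complex (expR (complex.Re s * ln n%:R)) 0.
Proof.
rewrite /natcpow norm_cexp; congr (Complex (expR _) 0).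
by case: s => x y; rewrite -[LHS]/(_ - _) mulr0 subr0.
Qed.

Definition dirichlet_conv (a b : nat -> C) : nat -> C := fun n =>
  \sum_(1 <= m < n.+1) \sum_(1 <= k < n.+1 | (m * k == n)%N) a m * b k.

Lemma dirichlet_conv_widen (a b : nat -> C) n N : (0 < n)%N -> (n <= N)%N ->
  dirichlet_conv a b n =
  \sum_(1 <= m < N.+1) \sum_(1 <= k < N.+1 | (m * k == n)%N) a m * b k.
Proof.
move=> n0 nN; rewrite /dirichlet_conv [RHS](big_cat_nat (n := n.+1))//=.
rewrite [X in _ = _ + X]big1_seq ?addr0; last first.
  move=> m; rewrite mem_index_iota => /and3P[_ nm _].
  rewrite big1_seq// => k; rewrite mem_index_iota => /and3P[/eqP mk k0 _].
  by exfalso; nia.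
apply: eq_big_nat => m /andP[m0 _]; rewrite [RHS](big_cat_nat (n := n.+1))//=.
rewrite [X in _ = _ + X]big1_seq ?addr0// => k.
by rewrite mem_index_iota => /and3P[/eqP mk k0 _]; exfalso; nia.
Qed.

Lemma dirichlet_sum_conv (a b : nat -> C) (s : C) N :
  dirichlet_sum a s N * dirichlet_sum b s N
    - dirichlet_sum (dirichlet_conv a b) s N =
  \sum_(1 <= m < N.+1) \sum_(1 <= k < N.+1 | (N < m * k)%N)
    (a m / natcpow m s) * (b k / natcpow k s).
Proof.
have -> : dirichlet_sum (dirichlet_conv a b) s N =
    \sum_(1 <= m < N.+1) \sum_(1 <= k < N.+1 | (m * k <= N)%N)
    (a m / natcpow m s) * (b k / natcpow k s).
  rewrite /dirichlet_sum.
  transitivity (\sum_(1 <= n < N.+1) \sum_(1 <= m < N.+1)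
      \sum_(1 <= k < N.+1) (if (m * k == n)%N then
         (a m / natcpow m s) * (b k / natcpow k s) else 0)).
    apply: eq_big_nat => n /andP[n0 nN].
    rewrite (@dirichlet_conv_widen _ _ _ N)//.
    rewrite mulr_suml; apply: eq_big_nat => m /andP[m0 mN].
    rewrite mulr_suml big_mkcond; apply: eq_big_nat => k /andP[k0 kN].
    case: eqP => // <-.
    by rewrite natcpowM// invfM; ring.
  rewrite exchange_big /=; apply: eq_big_nat => m /andP[m0 mN].
  rewrite exchange_big /= [RHS]big_mkcond /=.
  apply: eq_big_nat => k /andP[k0 kN]; case: ifPn => mk; last first.
    rewrite big1_seq// => n; rewrite mem_index_iota => /and3P[_ _ nN].
    by case: eqP => // mkn; exfalso; move: mk; rewrite mkn -ltnS nN.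
  rewrite (bigD1_seq (m * k)%N) ?iota_uniq//=; last first.
    by rewrite mem_index_iota ltnS mk andbT muln_gt0 m0.
  by rewrite eqxx big1 ?addr0// => n; rewrite eq_sym => /negPf ->.
rewrite /dirichlet_sum mulr_suml -sumrB; apply: eq_bigr => m _.
rewrite mulr_sumr (bigID (fun k => (m * k <= N)%N)) /=.
rewrite addrAC subrr add0r.
by apply: eq_bigl => k; rewrite -ltnNge.
Qed.
Lemma lec_complexr (x y : R) : (Complex x 0 <= Complex y 0 :> C) = (x <= y).
Proof. by rewrite lecE /= eqxx. Qed.

Lemma ltc_complexr (x y : R) : (Complex x 0 < Complex y 0 :> C) = (x < y).
Proof. by rewrite ltcE /= eqxx. Qed.

Lemma gt0_complexr (e : C) :
  0 < e -> 0 < complex.Re e /\ e = Complex (complex.Re e) 0.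
Proof. by case: e => x y; rewrite ltcE /= => /andP[/eqP -> ->]. Qed.

Lemma dirichlet_term_bounded (a : nat -> C) (s l : C) :
  dirichlet_sum a s @ \oo --> l ->
  exists2 M : R, 0 <= M &
    forall n, (0 < n)%N -> `|a n / natcpow n s| <= Complex M 0 :> C.
Proof.
move=> al; have /(@ex_strict_bound_gt0 _ _ _ _ _ _)[M M0 /= sM] :=
  cvg_seq_bounded (cvgP _ al).
have [rM Me] := gt0_complexr M0.
exists (complex.Re M + complex.Re M); first by rewrite addr_ge0// ltW.
move=> [//|n] _.
have -> : a n.+1 / natcpow n.+1 s =
    dirichlet_sum a s n.+1 - dirichlet_sum a s n.
  by rewrite /dirichlet_sum [X in _ = X - _]big_nat_recr//= addrAC subrr add0r.
apply: le_trans (ler_normB _ _) _.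
have -> : Complex (complex.Re M + complex.Re M) 0 = M + M :> C.
  by rewrite {3 4}Me -[RHS]/(Complex _ _) addr0.
by rewrite lerD// ltW// sM.
Qed.

Lemma dirichlet_term_decay (a : nat -> C) (s t : C) (M : R) n :
  (0 < n)%N -> 0 <= M ->
  `|a n / natcpow n s| <= Complex M 0 :> C ->
  complex.Re s + 3 <= complex.Re t ->
  `|a n / natcpow n t| <= Complex (M / n%:R ^+ 3) 0 :> C.
Proof.
move=> n0 M0 aM st.
have -> : a n / natcpow n t =
    a n / natcpow n s * (natcpow n s / natcpow n t).
  by rewrite mulrA divfK// natcpow_neq0.
rewrite normrM.
have -> : Complex (M / n%:R ^+ 3) 0 = Complex M 0 * Complex (n%:R ^- 3) 0 :> C.
  by rewrite -[RHS]/(Complex _ _) !mulr0 mul0r subr0 addr0.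
apply: ler_pM => //; rewrite normrM normfV !norm_natcpow.
set u := expR (complex.Re t * _).
have u0 : u != 0 by rewrite gt_eqF ?expR_gt0.
have -> : (Complex u 0)^-1 = Complex u^-1 0 :> C.
  rewrite -[LHS]/(Complex (u / (u ^+ 2 + 0 ^+ 2)) (- (0 / _))).
  by rewrite mul0r oppr0 expr0n /= addr0 expr2 invfM mulrA divff// mul1r.
rewrite -[X in X <= _]/(Complex _ _) !mulr0 mul0r subr0 addr0 lec_complexr.
rewrite /u -expRN -expRD -mulNr -mulrDl.
have ln0 : 0 <= ln (n%:R : R) by rewrite ln_ge0// ler1n.
have -> : (n%:R ^- 3 : R) = expR (- 3 * ln n%:R).
  by rewrite mulNr expRN expRM_natl lnK// posrE ltr0n.
by rewrite ler_expR ler_wpM2r//; lra.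
Qed.

Lemma cvg_dirichlet_conv (a b : nat -> C) (s f g : C) (Ma Mb : R) :
  0 <= Ma -> 0 <= Mb ->
  (forall n, (0 < n)%N ->
    `|a n / natcpow n s| <= Complex (Ma / n%:R ^+ 3) 0 :> C) ->
  (forall n, (0 < n)%N ->
    `|b n / natcpow n s| <= Complex (Mb / n%:R ^+ 3) 0 :> C) ->
  dirichlet_sum a s @ \oo --> f -> dirichlet_sum b s @ \oo --> g ->
  dirichlet_sum (dirichlet_conv a b) s @ \oo --> (f * g : C).
Proof.
move=> Ma0 Mb0 aM bM af bg.
pose d (N : nat) : C := dirichlet_sum a s N * dirichlet_sum b s N
    - dirichlet_sum (dirichlet_conv a b) s N.
have dle N : `|d N| <= Complex (Ma * Mb / N.+1%:R) 0 :> C.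
  rewrite /d dirichlet_sum_conv.
  apply: (@le_trans _ _ (\sum_(1 <= m < N.+1) \sum_(1 <= k < N.+1)
      (Complex (Ma * Mb / N.+1%:R ^+ 3) 0 : C))).
    apply: le_trans (ler_norm_sum _ _ _) _.
    rewrite big_nat_cond [leRHS]big_nat_cond.
    apply: ler_sum => m /andP[/andP[m0 _] _].
    apply: le_trans (ler_norm_sum _ _ _) _.
    rewrite big_mkcond big_nat_cond [leRHS]big_nat_cond /=.
    apply: ler_sum => k /andP[/andP[k0 _] _].
    have K0 : 0 <= Ma * Mb / N.+1%:R ^+ 3.
      by rewrite divr_ge0 ?mulr_ge0 ?exprn_ge0.
    case: ifPn => mk; last by rewrite (_ : 0 = Complex 0 0)// lec_complexr.
    rewrite normrM; apply: le_trans (ler_pM _ _ (aM _ m0) (bM _ k0)) _ => //.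
    rewrite -[X in X <= _]/(Complex _ _) !mulr0 mul0r subr0 addr0 lec_complexr.
    rewrite mulrACA ler_wpM2l ?mulr_ge0// -invfM -exprMn -natrM.
    rewrite lef_pV2 ?posrE ?exprn_gt0 ?ltr0n ?muln_gt0 ?m0//.
    by rewrite lerXn2r ?nnegrE// ler_nat.
  rewrite !big_const_nat !iter_addr !addr0 subn1 /= -mulrnA.
  have -> (x : R) n : (Complex x 0 : C) *+ n = Complex (x *+ n) 0.
    elim: n => [//|n IH]; rewrite !mulrS IH.
    by rewrite -[LHS]/(Complex _ _) addr0.
  rewrite lec_complexr -[leLHS]mulr_natr -!mulrA ler_wpM2l// ler_wpM2l//.
  have N0 : 0 < (N.+1%:R : R) by rewrite ltr0n.
  rewrite mulrC ler_pdivrMr ?exprn_gt0//.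
  have -> : (N.+1%:R^-1 : R) * N.+1%:R ^+ 3 = N.+1%:R * N.+1%:R.
    by field; rewrite gt_eqF.
  by rewrite -natrM ler_nat leq_mul.
have d0 : d @ \oo --> (0 : C).
  apply/cvgr0Pnorm_le => e e0; have [re0 ->] := gt0_complexr e0.
  have : (fun N => Ma * Mb * harmonic N) @ \oo --> (Ma * Mb * 0 : R).
    by apply: cvgMr; exact: cvg_harmonic.
  rewrite mulr0 => /cvgr0_norm_le /(_ _ re0).
  apply: filterS => N /= hN; apply: le_trans (dle N) _.
  by rewrite lec_complexr (le_trans (ler_norm _)).
have -> : dirichlet_sum (dirichlet_conv a b) s =
    (fun N => dirichlet_sum a s N * dirichlet_sum b s N - d N).
  by apply/funext => N; rewrite /d subKr.
have ab := @cvgM R[i] _ _ eventually_filter _ _ _ _ af bg.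
by have := @cvgB R[i] C _ _ eventually_filter _ _ _ _ ab d0; rewrite subr0.
Qed.

Lemma represented_by_dirichletM f g : represented_by_dirichlet f ->
  represented_by_dirichlet g -> represented_by_dirichlet (f * g).
Proof.
move=> [a [sa fa]] [b [sb gb]].
pose t : R := Num.max 0 (Num.max sa sb) + 1.
have t0 : halfplane (Complex t 0).
  by rewrite /halfplane /= ltr_wpDl// le_max lexx.
have ta : sa < t by rewrite ltr_pwDr// !le_max lexx !orbT.
have tb : sb < t by rewrite ltr_pwDr// !le_max lexx !orbT.
pose s0 : halfplane := SigSub (mem_set t0).
have [Ma Ma0 aM] := dirichlet_term_bounded (fa s0 ta).
have [Mb Mb0 bM] := dirichlet_term_bounded (gb s0 tb).
exists (dirichlet_conv a b), (t + 3) => s st.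
apply: (cvg_dirichlet_conv Ma0 Mb0).
- move=> n n0; apply: dirichlet_term_decay (aM n n0) _ => //.
  exact: ltW.
- move=> n n0; apply: dirichlet_term_decay (bM n n0) _ => //.
  exact: ltW.
- by apply: fa; apply: lt_trans st; rewrite ltr_wpDr.
- by apply: gb; apply: lt_trans st; rewrite ltr_wpDr.
Qed.

Lemma represented_by_dirichletB f g : represented_by_dirichlet f ->
  represented_by_dirichlet g -> represented_by_dirichlet (f - g).
Proof.
move=> [a [sa fa]] [b [sb gb]].
exists (fun n => a n - b n), (Num.max sa sb) => s.
rewrite gt_max => /andP[sas sbs].
have -> : dirichlet_sum (fun n => a n - b n) (val s) =
    (fun N => dirichlet_sum a (val s) N - dirichlet_sum b (val s) N).
  by apply/funext => N; rewrite /dirichlet_sum -sumrB; apply: eq_bigr => n _;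
    rewrite mulrBl.
by apply: cvgB; [exact: fa|exact: gb].
Qed.

Lemma represented_by_dirichlet1 : represented_by_dirichlet 1.
Proof.
exists (fun n => (n == 1%N)%:R), 0 => s _.
apply: cvg_near_cst; exists 1%N => // N /= N0.
rewrite /dirichlet_sum big_ltn ?ltnS// eqxx natcpow1 divr1 big1_seq ?addr0//.
move=> n; rewrite mem_index_iota => /andP[_ /andP[n1 _]].
by rewrite gtn_eqF// mul0r.
Qed.

Lemma holomorphic_halfplane1 : holomorphic_halfplane 1.
Proof.
move=> s s0; apply: (@near_eq_derivable R[i] C C (cst 1)); last first.
  exact: derivable_cst.
apply: filterS (halfplane_nbhs s0) => w w0; symmetry.
have E := valLK (0 : C) (1 : halfplane -> C).
exact: (congr1 (fun F => F (SigSub (mem_set w0))) E).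
Qed.

Lemma holomorphic_halfplaneB f g : holomorphic_halfplane f ->
  holomorphic_halfplane g -> holomorphic_halfplane (f - g).
Proof.
move=> hf hg s s0.
have -> : 'valL_(0 : C) (f - g) = 'valL_(0 : C) f - 'valL_(0 : C) g :> (C -> C).
  by apply/funext => w /=; rewrite !fctE /=; case: ('oinv_set_val w) => //=;
    rewrite subr0.
by apply: derivableB; [exact: hf|exact: hg].
Qed.

Lemma holomorphic_halfplaneM f g : holomorphic_halfplane f ->
  holomorphic_halfplane g -> holomorphic_halfplane (f * g).
Proof.
move=> hf hg s s0.
have -> : 'valL_(0 : C) (f * g) = 'valL_(0 : C) f * 'valL_(0 : C) g :> (C -> C).
  by apply/funext => w /=; rewrite !fctE /=; case: ('oinv_set_val w) => //=;
    rewrite mulr0.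
by apply: (@derivableM R[i]); [exact: hf|exact: hg].
Qed.

Lemma bounded_halfplaneP (f : halfplane -> C) :
  bounded_fun f <-> exists M : C, forall s, `|f s| <= M.
Proof.
have one : halfplane (Complex 1 0) by rewrite /halfplane /=.
have FF := globally_properfilter (I : [set: halfplane] (SigSub (mem_set one))).
split=> [/ex_bound[M fM]|[M fM]]; first by exists M => s; exact: fM.
by apply/ex_bound; exists M => s _; exact: fM.
Qed.

Lemma bounded_halfplaneB (f g : halfplane -> C) :
  bounded_fun f -> bounded_fun g -> bounded_fun (f - g).
Proof.
move=> /bounded_halfplaneP[M fM] /bounded_halfplaneP[N gN].
apply/bounded_halfplaneP; exists (M + N) => s.
exact: le_trans (ler_normB _ _) (lerD (fM s) (gN s)).
Qed.

Lemma bounded_halfplaneM (f g : halfplane -> C) :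
  bounded_fun f -> bounded_fun g -> bounded_fun (f * g).
Proof.
move=> /bounded_halfplaneP[M fM] /bounded_halfplaneP[N gN].
apply/bounded_halfplaneP; exists (M * N) => s.
by apply: le_trans (ler_pM _ _ (fM s) (gN s)) => //; rewrite -normrM.
Qed.

Lemma Hinfty_subring_closed : subring_closed Hinfty.
Proof.
split.
- apply/asboolP; split; [exact: holomorphic_halfplane1| |
    exact: represented_by_dirichlet1].
  by apply/bounded_halfplaneP; exists 1 => s; rewrite normr1.
- move=> f g /asboolP[hf bf rf] /asboolP[hg bg rg]; apply/asboolP; split.
  + exact: holomorphic_halfplaneB.
  + exact: bounded_halfplaneB.
  + exact: represented_by_dirichletB.
- move=> f g /asboolP[hf bf rf] /asboolP[hg bg rg]; apply/asboolP; split.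
  + exact: holomorphic_halfplaneM.
  + exact: bounded_halfplaneM.
  + exact: represented_by_dirichletM.
Qed.

HB.instance Definition _ :=
  GRing.isSubringClosed.Build (halfplane -> C) Hinfty Hinfty_subring_closed.

Record HinftyType := HinftyElt {
  Hinfty_fun :> halfplane -> C;
  HinftyP : Hinfty_fun \in Hinfty }.

HB.instance Definition _ := [isSub for Hinfty_fun].
HB.instance Definition _ := [Choice of HinftyType by <:].
HB.instance Definition _ :=
  GRing.SubChoice_isSubComPzRing.Build (halfplane -> C) _ HinftyType
    (subringClosedP _).

End BoundedDirichletSeries.

(* Main.v *)
From HB Require Import structures.
Require Import Defs.
From mathcomp Require Import all_boot all_order all_algebra all_fingroup.
From mathcomp Require Import complex ring lra zify.
From mathcomp Require Import all_classical all_reals all_analysis.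
Set Implicit Arguments.
Unset Strict Implicit.
Unset Printing Implicit Defensive.
Import Order.TTheory GRing.Theory Num.Theory numFieldNormedType.Exports.
Local Open Scope classical_set_scope.
Local Open Scope ring_scope.

(** Fix [n] and distinct primes [p_j], [q_j], [j < n]; write [z_j = p_j^-s],
    [w_j = q_j^-s] and [g = c - sum_j z_j w_j] for a small real [c > 0].  The row
    [(z_1, ..., z_n, g)] is unimodular, because [sum_j w_j z_j + g = c].  Suppose
    that it is reducible, that is, that bounded Dirichlet series [x_j], [b_j]
    satisfy [sum_j b_j u_j = 1] with [u_j = z_j + x_j g].  By Bohr's point of view
    everything is a power series in the variables [p^-s], and on the ball where
    [w_j] is the conjugate of [z_j] and [sum_j |z_j|^2 <= c] the map
    [u = (u_1, ..., u_n)] has no zero and is the identity on the boundary, where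
    [g = 0].  The non-existence of a retraction of a ball onto its boundary
    forbids this, for every [n].

    The no-retraction theorem is proved in an algebraic form that applies to
    power series directly.  With [b'_j = w_j - g (sum_i w_i x_i - 1) b_j] one
    has [sum_j b'_j u_j = c], so the map [(u, b')] takes values in the quadric
    [sum_j b'_j u_j = c] and its Jacobian determinant in the [2n] variables
    [(z, w)] vanishes identically ([det0_of_kernel]).  On the other hand
    [(u, b')] is the identity [(z, w)] plus a multiple of [g].  The integral
    over the ball of a partial derivative of a multiple of [g] is zero, [g]
    being zero on the boundary, and Jacobian determinants have divergence
    form; hence the integral of the Jacobian does not see the multiple of [g]
    ([integral_jacobian_perturb]) and equals the volume of the ball, which is not
    zero.  Only the moments of the ball enter: they are explicit
    ([ball_moment]), and the vanishing of boundary terms is a recursion between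
    them ([ball_moment_stokes]).  So the argument lives in the ring [dseries] of
    coefficient sequences under Dirichlet convolution, with the partial
    derivatives [pderiv] with respect to [p^-s].

    It remains to send a bounded Dirichlet series to its coefficients.  The
    moments decay at the fixed rate [m^-4], so the coefficients of every
    bounded Dirichlet series must be controlled on a fixed half-plane, although
    the series is only assumed to converge somewhere.  If [|f| <= M], then
    [|a_n| <= 2 M n]: the coefficient [a_n] is the mean value of [f(s) n^s] on a far
    vertical line ([mean_value_coef]), and Cauchy's theorem on long rectangles
    ([goursat_rectangle]) moves that line to abscissa [1]
    ([represents_Im_le]).  The same mean values give uniqueness of the
    coefficients, so that [coef] is a ring morphism from the bounded
    Dirichlet series to [dseries]. *)

(** * Jacobian determinants and a functional that kills boundary terms *)
Section JacobianAlgebra.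
Variables (A : comPzRingType) (m : nat) (d : 'I_m -> {additive A -> A}).
Hypothesis dM : forall i x y, d i (x * y) = d i x * y + x * d i y.
Hypothesis dC : forall i j x, d i (d j x) = d j (d i x).

Lemma deriv1 i : d i 1 = 0.
Proof.
by apply: (addrI (d i 1)); rewrite addr0 -[in RHS](mulr1 1) dM mulr1 mul1r.
Qed.

Lemma deriv_prod (I : finType) (P : pred I) (F : I -> A) i :
  d i (\prod_(k | P k) F k) =
  \sum_(k | P k) d i (F k) * \prod_(l | P l && (l != k)) F l.
Proof.
have [n] := ubnP #|P|; elim: n P => // n IH P Pn.
case: (pickP P) => [k Pk|P0]; last by rewrite !big_pred0// deriv1.
rewrite (bigD1 k)//= dM [RHS](bigD1 k)//=; congr (_ + _).
rewrite IH; last first.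
  rewrite -ltnS (leq_trans _ Pn)// ltnS proper_card//; apply/properP; split.
    by apply/fintype.subsetP => l; rewrite !unfold_in => /andP[].
  by exists k; rewrite unfold_in ?Pk ?eqxx.
rewrite mulr_sumr; apply: eq_bigr => l /andP[Pl lk].
rewrite [in RHS](bigD1 k) ?Pk 1?eq_sym//= mulrCA; congr (_ * (_ * _)).
by apply: eq_bigl => j; rewrite andbAC.
Qed.

Definition jacobian (f : 'I_m -> A) : 'M[A]_m := \matrix_(k, j) d j (f k).

(** The rows other than [r] contribute a second derivative [d_(s r) d_(s k) f_k],
    symmetric under exchanging the values of [s] at [r] and [k], whereas the
    signature changes sign: the terms cancel in pairs. *)
Lemma minors_divergence_free (f : 'I_m -> A) (r : 'I_m) :
  \sum_(s : 'S_m) (-1) ^+ s * d (s r) (\prod_(k | k != r) d (s k) (f k)) = 0.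
Proof.
under eq_bigr do rewrite deriv_prod mulr_sumr.
rewrite exchange_big big1//= => k kr.
rewrite (bigID (fun s : 'S_m => odd_perm s)) /=.
rewrite [X in X + _](reindex_inj (mulgI (tperm r k))) /=.
under [X in X + _]eq_bigl do rewrite odd_mul_tperm eq_sym kr addTb.
apply/eqP; rewrite addr_eq0 -sumrN; apply/eqP; apply: eq_bigr => s sodd.
rewrite odd_mul_tperm eq_sym kr addTb sodd (negPf sodd) mulN1r mul1r.
rewrite !permM tpermL tpermR dC; congr (- (_ * _)).
apply: eq_bigr => l /andP[lr lk].
by rewrite permM tpermD// eq_sym.
Qed.

(** [L] stands for the integral over a domain on whose boundary [g] vanishes. *)
Variables (V : zmodType) (L : {additive A -> V}) (g : A).
Hypothesis Lg : forall i h, L (d i (g * h)) = 0.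

(** By [minors_divergence_free] the determinant is the divergence of the field
    with components [g h] times the minors of row [r]. *)
Lemma integral_jacobian_row (f : 'I_m -> A) (r : 'I_m) (h : A) :
  f r = g * h -> L (\det (jacobian f)) = 0.
Proof.
move=> fr; pose P (s : 'S_m) := \prod_(k | k != r) d (s k) (f k).
have detE : \det (jacobian f) =
    \sum_(s : 'S_m) (-1) ^+ s * d (s r) (g * (h * P s)).
  have := minors_divergence_free f r => /(congr1 ( *%R (f r))).
  rewrite mulr0 => /(congr1 (+%R (\det (jacobian f)))); rewrite addr0 => <-.
  rewrite mulr_sumr -big_split /=.
  apply: eq_bigr => s _; rewrite (bigD1 r)//= mxE mulrA -fr dM mulrDr.
  congr (_ + _); last by rewrite mulrCA.
  by congr (_ * (_ * _)); apply: eq_bigr => k _; rewrite mxE.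
rewrite detE raddf_sum big1// => s _.
by rewrite mulr_sign; case: ifP; rewrite ?raddfN /= Lg// oppr0.
Qed.

Lemma det_jacobianDr (f1 f2 f : 'I_m -> A) r :
  f r = f1 r + f2 r ->
  (forall k, k != r -> f1 k = f k /\ f2 k = f k) ->
  \det (jacobian f) = \det (jacobian f1) + \det (jacobian f2).
Proof.
move=> fr fk; rewrite (@determinant_multilinear _ _ _ (jacobian f1)
  (jacobian f2) r 1 1) ?mul1r//.
- by apply/rowP => j; rewrite !mxE fr raddfD !mul1r.
- by apply/matrixP => i j; rewrite !mxE; have [|->] := fk (lift r i);
    rewrite 1?eq_sym ?neq_lift.
- by apply/matrixP => i j; rewrite !mxE; have [|_ ->] := fk (lift r i);
    rewrite 1?eq_sym ?neq_lift.
Qed.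

(** The rows are perturbed one at a time, by multilinearity. *)
Lemma integral_jacobian_perturb (f h : 'I_m -> A) :
  L (\det (jacobian (fun k => f k + g * h k))) = L (\det (jacobian f)).
Proof.
pose F (B : {set 'I_m}) k := if k \in B then f k + g * h k else f k.
suff FE B : L (\det (jacobian (F B))) = L (\det (jacobian f)).
  rewrite -(FE [set: 'I_m]%SET); congr (L (\det _)).
  by apply/matrixP => i j; rewrite !mxE /F inE.
have [n] := ubnP #|B|; elim: n B => // n IH B Bn.
have [->|[r rB]] := set_0Vmem B.
  by congr (L (\det _)); apply/matrixP => i j; rewrite !mxE /F inE.
rewrite (@det_jacobianDr (F (B :\ r)%SET)
  (fun k => if k == r then g * h r else F B k) _ r); last 2 first.
- by rewrite /F rB !inE eqxx.
- by move=> k kr; rewrite (negPf kr) /F !inE kr.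
rewrite raddfD /= [X in _ + X](@integral_jacobian_row _ r (h r)) ?eqxx// addr0.
by apply: IH; rewrite -ltnS (leq_trans _ Bn)// ltnS [leqRHS](cardsD1 r) rB.
Qed.

End JacobianAlgebra.

Lemma det0_of_kernel (A : comPzRingType) m (M : 'M[A]_m) (v y : 'I_m -> A) :
  (forall j, \sum_k v k * M k j = 0) -> \sum_k v k * y k = 1 -> \det M = 0.
Proof.
move=> vM vy; pose V := \row_k v k; pose Y := \col_k y k.
have VY : (V *m Y) 0 0 = 1 by rewrite !mxE -[RHS]vy; apply: eq_bigr => k _; rewrite !mxE.
have VM : V *m M = 0.
  by apply/rowP => j; rewrite !mxE -[RHS](vM j); apply: eq_bigr => k _; rewrite !mxE.
have : (V *m M *m \adj M *m Y) 0 0 = \det M.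
  by rewrite -(mulmxA V) mul_mx_adj mul_mx_scalar -scalemxAl mxE VY mulr1.
by rewrite VM !mul0mx mxE.
Qed.

Section Obstruction.
Variables (A : comPzRingType) (n : nat) (d : 'I_(n + n) -> {additive A -> A}).
Hypothesis dM : forall i x y, d i (x * y) = d i x * y + x * d i y.
Hypothesis dC : forall i j x, d i (d j x) = d j (d i x).
Variables (V : zmodType) (L : {additive A -> V}) (e : 'I_(n + n) -> A) (c : A).
Hypothesis de : forall i j, d i (e j) = (i == j)%:R.
Hypothesis dc : forall i, d i c = 0.
Let z j := e (lshift n j).
Let w j := e (rshift n j).
Let g := c - \sum_j z j * w j.
Hypothesis Lg : forall i h, L (d i (g * h)) = 0.
Hypothesis L1 : L 1 != 0.

(** An algebraic no-retraction theorem: the [2n] elements [e] behave as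
    coordinates [(z, w)], and [g] as the equation of the sphere. *)
Lemma no_unimodular_perturbation (x b : 'I_n -> A) :
  \sum_j b j * (z j + x j * g) = 1 -> False.
Proof.
move=> bu; pose u j := z j + x j * g.
(* The choice of [k] makes the products of [b'] and [u] add up to [c] exactly:
   those of [w] and [u] add up to [c + g * k], and those of [b] and [u] to 1. *)
pose k := \sum_j w j * x j - 1.
pose b' j := w j - g * k * b j.
have b'u : \sum_j b' j * u j = c.
  have -> : \sum_j b' j * u j = \sum_j z j * w j + g * (\sum_j w j * x j)
      - g * k * (\sum_j b j * u j).
    rewrite !mulr_sumr -big_split /= -sumrB; apply: eq_bigr => j _.
    by rewrite /b' /u; ring.
  by rewrite bu /k /g; ring.
pose phi (i : 'I_(n + n)) := match fintype.split i with inl j => u j | inr j => b' j end.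
pose psi (i : 'I_(n + n)) :=
  match fintype.split i with inl j => x j | inr j => - (k * b j) end.
have phiE i : phi i = e i + g * psi i.
  rewrite /phi /psi -[in e i](splitK i); case: (fintype.split i) => j /=.
    by rewrite /u /z mulrC.
  by rewrite /b' /w mulrN mulrA.
have phil j : phi (lshift n j) = u j by rewrite /phi (unsplitK (inl j)).
have phir j : phi (rshift n j) = b' j by rewrite /phi (unsplitK (inr j)).
(* Differentiating the constant [sum_j b'_j u_j] gives a linear relation between
   the rows of the Jacobian matrix of [phi = (u, b')]. *)
have det0 : \det (jacobian d phi) = 0.
  apply: (@det0_of_kernel _ _ _
    (fun i => match fintype.split i with inl j => b' j | inr j => u j end)
    (fun i => match fintype.split i with inl j => 0 | inr j => b j end)).
    move=> j; rewrite big_split_ord /=.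
    have := congr1 (d j) b'u; rewrite dc raddf_sum /= => b'u0.
    rewrite -[RHS]b'u0 -big_split /=; apply: eq_bigr => i _.
    by rewrite !mxE phil phir (unsplitK (inl i)) (unsplitK (inr i)) dM; ring.
  rewrite big_split_ord /= big1 ?add0r => [|i _]; last first.
    by rewrite (unsplitK (inl i)) mulr0.
  rewrite -[RHS]bu; apply: eq_bigr => i _.
  by rewrite (unsplitK (inr i)) mulrC.
have := @integral_jacobian_perturb A _ d dM dC V L g Lg e psi.
have -> : jacobian d (fun i => e i + g * psi i) = jacobian d phi.
  by apply/matrixP => i j; rewrite !mxE phiE.
have -> : jacobian d e = 1%:M by apply/matrixP => i j; rewrite !mxE de eq_sym.
by rewrite det0 det1 raddf0 => /esym /eqP; apply/negP.
Qed.
End Obstruction.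

(** * Real-valued modulus and Dirichlet convolution *)

Section RealNorm.
Variable R : realType.
Local Notation C := (R[i]^o).

(** The library norm of [R[i]] takes values in [R[i]] itself. *)
Definition nrm (z : C) : R := complex.Re `|z|.

Lemma normE (z : C) : `|z| = Complex (nrm z) 0.
Proof. by case: z. Qed.

Lemma nrm_ge0 (z : C) : 0 <= nrm z.
Proof. by rewrite -lec_complexr -normE normr_ge0. Qed.

Lemma nrm0 : nrm 0 = 0.
Proof. by rewrite /nrm normr0. Qed.

Lemma nrm1 : nrm 1 = 1.
Proof. by rewrite /nrm normr1. Qed.

Lemma nrmD (z w : C) : nrm (z + w) <= nrm z + nrm w.
Proof.
rewrite -lec_complexr -normE (le_trans (ler_normD _ _))// !normE.
by rewrite [leLHS](_ : _ = Complex (nrm z + nrm w) 0)// -[LHS]/(Complex _ _) addr0.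
Qed.

Lemma nrmN (z : C) : nrm (- z) = nrm z.
Proof. by rewrite /nrm normrN. Qed.

Lemma nrmB (z w : C) : nrm (z - w) <= nrm z + nrm w.
Proof. by rewrite (le_trans (nrmD _ _))// nrmN. Qed.

Lemma nrmM (z w : C) : nrm (z * w) = nrm z * nrm w.
Proof. by rewrite {1}/nrm normrM !normE /= mul0r subr0. Qed.

Lemma nrm_sum I (r : seq I) (P : pred I) (F : I -> C) :
  nrm (\sum_(i <- r | P i) F i) <= \sum_(i <- r | P i) nrm (F i).
Proof.
elim/big_ind2 : _ => // [|x u y v xu yv]; first by rewrite nrm0.
by rewrite (le_trans (nrmD _ _))// lerD.
Qed.

Lemma nrmE (z : C) : nrm z = Num.sqrt (complex.Re z ^+ 2 + complex.Im z ^+ 2).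
Proof. by case: z. Qed.

Lemma nrm_real (x : R) : nrm (Complex x 0) = `|x|.
Proof. by rewrite nrmE /= expr0n addr0 sqrtr_sqr. Qed.

Lemma Re_le_nrm (z : C) : `|complex.Re z| <= nrm z.
Proof. by rewrite nrmE -sqrtr_sqr ler_wsqrtr// lerDl sqr_ge0. Qed.

Lemma Im_le_nrm (z : C) : `|complex.Im z| <= nrm z.
Proof. by rewrite nrmE -sqrtr_sqr ler_wsqrtr// lerDr sqr_ge0. Qed.

Lemma nrm_le_ReIm (z : C) : nrm z <= `|complex.Re z| + `|complex.Im z|.
Proof.
rewrite nrmE -[leRHS]ger0_norm ?addr_ge0// -sqrtr_sqr ler_wsqrtr// sqrrD.
by rewrite !real_normK ?num_real// lerD2r lerDl mulrn_wge0// mulr_ge0.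
Qed.

End RealNorm.

Section DirichletConvolution.
Variable R : realType.
Local Notation C := (R[i]^o).
Implicit Types (a b c : nat -> C) (n k N : nat).

Lemma convE N a b n : (0 < n)%N -> (n <= N)%N ->
  dirichlet_conv a b n = \sum_(1 <= m < N.+1) \sum_(1 <= k < N.+1)
    (a m * b k) *+ (m * k == n)%N.
Proof.
move=> n0 nN; rewrite (dirichlet_conv_widen _ _ n0 nN); apply: eq_bigr => m _.
by rewrite big_mkcond; apply: eq_bigr => k _; case: eqP => //=.
Qed.

Lemma conv_at0 a b : dirichlet_conv a b 0 = 0.
Proof. by rewrite /dirichlet_conv big_geq. Qed.

Lemma convC a b : dirichlet_conv a b = dirichlet_conv b a.
Proof.
apply/funext => -[|n]; first by rewrite !conv_at0.
rewrite !(@convE n.+1)// exchange_big; apply: eq_bigr => m _.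
by apply: eq_bigr => k _; rewrite mulrC mulnC.
Qed.

Lemma convDl a b c :
  dirichlet_conv (a + b) c = dirichlet_conv a c + dirichlet_conv b c.
Proof.
apply/funext => n; rewrite -[RHS]/(_ + _) /dirichlet_conv -big_split /=.
apply: eq_bigr => m _; rewrite -big_split /=; apply: eq_bigr => k _.
by rewrite -mulrDl.
Qed.

(** A form symmetric in the three factors, which makes associativity an
    exchange of sums. *)
Lemma conv3E N a b c n : (0 < n)%N -> (n <= N)%N ->
  dirichlet_conv a (dirichlet_conv b c) n =
  \sum_(1 <= m < N.+1) \sum_(1 <= j < N.+1) \sum_(1 <= k < N.+1)
    (a m * (b j * c k)) *+ (m * (j * k) == n)%N.
Proof.
move=> n0 nN; rewrite (convE _ _ n0 nN); apply: eq_big_nat => m /andP[m0 mN].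
transitivity (\sum_(1 <= l < N.+1) \sum_(1 <= j < N.+1) \sum_(1 <= k < N.+1)
   (a m * (b j * c k)) *+ ((m * l == n) && (j * k == l))%N).
  apply: eq_big_nat => l /andP[l0 lN]; rewrite (convE _ _ l0 lN).
  rewrite mulr_sumr -sumrMnl; apply: eq_bigr => j _.
  rewrite mulr_sumr -sumrMnl; apply: eq_bigr => k _.
  by rewrite -mulrnAr -mulrnAr; case: eqP; case: eqP; rewrite ?mulr0n ?mulr0.
rewrite exchange_big; apply: eq_big_nat => j /andP[j0 jN].
rewrite exchange_big; apply: eq_big_nat => k /andP[k0 kN].
have [E|E] := eqVneq (m * (j * k))%N n; last first.
  rewrite big1 ?mulr0n// => l _; case: eqP => //= ml; case: eqP => //= jk.
  by move: E; rewrite jk ml eqxx.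
rewrite (bigD1_seq (j * k)%N) ?iota_uniq//=; last first.
  by rewrite mem_index_iota; nia.
rewrite E !eqxx big1 ?addr0// => l /negPf jkl.
by rewrite eq_sym in jkl; rewrite jkl andbF.
Qed.

Lemma convA a b c :
  dirichlet_conv a (dirichlet_conv b c) = dirichlet_conv (dirichlet_conv a b) c.
Proof.
apply/funext => -[|n]; first by rewrite !conv_at0.
rewrite (convC (dirichlet_conv a b)) !(@conv3E n.+1)// [RHS]exchange_big; apply: eq_bigr => m _.
rewrite [RHS]exchange_big; apply: eq_bigr => j _; apply: eq_bigr => k _.
by rewrite mulrA mulrC (mulnC k) mulnA.
Qed.

(** The coefficients of the monomial [k^-s]. *)
Definition unit_seq (k : nat) : nat -> C := fun n => (n == k)%:R.

Lemma conv_unit_seq k a n : (0 < k)%N -> (0 < n)%N ->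
  dirichlet_conv (unit_seq k) a n = if (k %| n)%N then a (n %/ k)%N else 0.
Proof.
move=> k0 n0; case: ifPn => kn; last first.
  rewrite /dirichlet_conv big1// => m _; rewrite big1// => j /eqP mj.
  rewrite /unit_seq; case: eqP => [mk|]; rewrite ?mul0r//.
  by move: kn; rewrite -mj mk dvdn_mulr.
have nk : (0 < n %/ k)%N by rewrite divn_gt0// dvdn_leq.
rewrite (@convE n)// (bigD1_seq k) ?iota_uniq//=; last first.
  by rewrite mem_index_iota k0 ltnS dvdn_leq.
rewrite [X in _ + X]big1 ?addr0 => [|m /negPf mk]; last first.
  by rewrite big1// => j _; rewrite /unit_seq mk mul0r mul0rn.
rewrite (bigD1_seq (n %/ k)%N) ?iota_uniq//=; last first.
  by rewrite mem_index_iota nk ltnS leq_div.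
rewrite mulnC divnK// eqxx /unit_seq eqxx mul1r big1 ?addr0// => j /negPf jk.
case: eqP => // kj; move: jk.
by rewrite -kj mulKn// eqxx.
Qed.

End DirichletConvolution.

(** * Weighted absolute summability of coefficient sequences *)

Section Weights.
Variable R : realType.
Local Notation C := (R[i]^o).
Implicit Types (a b : nat -> C) (n k N : nat) (t : R).

Lemma sum_multiples (V : nmodType) (h : nat -> V) p N : (0 < p)%N ->
  \sum_(1 <= n < N.+1) h (n * p)%N = \sum_(1 <= m < (N * p).+1 | (p %| m)%N) h m.
Proof.
move=> p0; elim: N => [|N IH]; first by rewrite mul0n !big_geq.
rewrite big_nat_recr//= IH [RHS](@big_cat_nat _ _ _ (N * p).+1)//=; last first.
  by rewrite ltnS leq_mul2r leqnSn orbT.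
congr (_ + _); rewrite -big_filter (_ : [seq _ <- _ | _] = [:: (N.+1 * p)%N]).
  by rewrite big_seq1.
have -> : index_iota (N * p).+1 (N.+1 * p).+1 =
    rcons (index_iota (N * p).+1 (N.+1 * p)) (N.+1 * p)%N.
  rewrite /index_iota subSS mulSn addnK -[X in (p + _ - X)%N]addn1 subnDA addnK.
  rewrite subn1 -[X in iota _ X = _](prednK p0) -[p.-1.+1]addn1 iotaD cats1.
  by congr rcons; rewrite addSn -addnS prednK// addnC.
rewrite filter_rcons /= modnMl eqxx (eq_in_filter (a2 := pred0)) ?filter_pred0//.
move=> m; rewrite mem_index_iota => /andP[Nm mN] /=; apply/negbTE/negP.
by move=> /dvdnP[q mq]; move: Nm mN; rewrite mq ltn_mul2r p0 /= ltn_mul2r p0/=; lia.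
Qed.

(** [n^-t]. *)
Definition wt t n : R := expR (- (t * ln n%:R)).

Lemma wt_gt0 t n : 0 < wt t n. Proof. exact: expR_gt0. Qed.

Lemma wt_ge0 t n : 0 <= wt t n. Proof. exact: expR_ge0. Qed.

Lemma wtM t m k : (0 < m)%N -> (0 < k)%N -> wt t (m * k) = wt t m * wt t k.
Proof.
move=> m0 k0; rewrite /wt natrM lnM ?posrE ?ltr0n// -expRD.
by congr expR; ring.
Qed.

Lemma wtD t u n : wt (t + u) n = wt t n * wt u n.
Proof. by rewrite /wt -expRD; congr expR; ring. Qed.

Lemma le_wt t u n : (0 < n)%N -> t <= u -> wt u n <= wt t n.
Proof. by move=> n0 tu; rewrite ler_expR lerN2 ler_wpM2r// ln_ge0// ler1n. Qed.

(** Differentiation multiplies coefficients by valuations; these grow only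
    logarithmically, so they cost an arbitrarily small part of the weight. *)
Lemma logn_wt t p n : 0 < t -> (0 < n)%N -> (logn p n)%:R * wt t n <= (t * ln 2)^-1.
Proof.
move=> t0 n0; have ln2 : 0 < ln (2 : R) by rewrite ln_gt0// ltr1n.
have K0 : 0 < t * ln 2 by rewrite mulr_gt0.
have [pp|npp] := boolP (prime p); last first.
  by rewrite lognE (negPf npp) mul0r invr_ge0 ltW.
have lnl : (logn p n)%:R * ln 2 <= ln n%:R :> R.
  rewrite mulr_natl -lnXn// ler_ln ?posrE ?exprn_gt0 ?ltr0n// -natrX ler_nat.
  apply: (@leq_trans (p ^ logn p n)); last by rewrite dvdn_leq ?pfactor_dvdnn.
  by case: (logn p n) => // v; rewrite leq_exp2r// prime_gt1.
rewrite -(ler_pM2r K0) mulVf ?gt_eqF//.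
have -> : (logn p n)%:R * wt t n * (t * ln 2) =
    t * ((logn p n)%:R * ln 2) / expR (t * ln n%:R) by rewrite /wt expRN; ring.
rewrite ler_pdivrMr ?expR_gt0// mul1r.
rewrite (le_trans _ (expR_ge1Dx _))// (le_trans (ler_wpM2l (ltW t0) lnl))//.
by rewrite lerDr.
Qed.

Definition wsum t a N : R := \sum_(1 <= n < N.+1) nrm (a n) * wt t n.

Lemma wsum_ge0 t a N : 0 <= wsum t a N.
Proof. by apply: sumr_ge0 => n _; rewrite mulr_ge0 ?nrm_ge0 ?wt_ge0. Qed.

Lemma le_wsum t u a N : t <= u -> wsum u a N <= wsum t a N.
Proof.
move=> tu; rewrite /wsum big_nat [leRHS]big_nat; apply: ler_sum => n /andP[n0 _].
by rewrite ler_wpM2l ?nrm_ge0 ?le_wt.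
Qed.

Lemma wsumB t a b N : wsum t (a - b) N <= wsum t a N + wsum t b N.
Proof.
rewrite -big_split /=; apply: ler_sum => n _.
by rewrite -mulrDl ler_wpM2r ?wt_ge0 ?nrmB.
Qed.

(** Weights are completely multiplicative, and a product [m k <= N] has both
    factors at most [N]. *)
Lemma wsum_conv t a b N : wsum t (dirichlet_conv a b) N <= wsum t a N * wsum t b N.
Proof.
have -> : wsum t a N * wsum t b N = \sum_(1 <= m < N.+1) \sum_(1 <= k < N.+1)
    nrm (a m) * nrm (b k) * wt t (m * k)%N.
  rewrite mulr_suml; apply: eq_big_nat => m /andP[m0 _].
  rewrite mulr_sumr; apply: eq_big_nat => k /andP[k0 _].
  by rewrite wtM// mulrACA.
apply: (@le_trans _ _ (\sum_(1 <= n < N.+1) \sum_(1 <= m < N.+1)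
    \sum_(1 <= k < N.+1) (nrm (a m) * nrm (b k) * wt t (m * k)%N) *+ (m * k == n)%N)).
  rewrite /wsum big_nat [leRHS]big_nat; apply: ler_sum => n /andP[n0 nN].
  rewrite (convE _ _ n0 nN) (le_trans (ler_wpM2r (wt_ge0 _ _) (nrm_sum _ _ _)))//.
  rewrite mulr_suml; apply: ler_sum => m _.
  rewrite (le_trans (ler_wpM2r (wt_ge0 _ _) (nrm_sum _ _ _)))// mulr_suml.
  apply: ler_sum => k _; case: eqP => [<-|]; first by rewrite nrmM.
  by rewrite !mulr0n nrm0 mul0r.
rewrite exchange_big; apply: ler_sum => m _ /=.
rewrite exchange_big; apply: ler_sum => k _ /=.
have T0 : 0 <= nrm (a m) * nrm (b k) * wt t (m * k)%N.
  by rewrite !mulr_ge0 ?nrm_ge0 ?wt_ge0.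
have [mkN|mkN] := boolP ((m * k)%N \in index_iota 1 N.+1).
  rewrite (bigD1_seq (m * k)%N) ?iota_uniq//= eqxx big1 ?addr0// => n.
  by rewrite eq_sym => /negPf ->.
rewrite big1_seq// => n /= nN; case: eqP => // mk.
by move: mkN; rewrite mk nN.
Qed.

(** The partial derivative with respect to the variable [p^-s] of a Dirichlet
    series regarded as a power series in the variables [p^-s], [p] prime. *)
Definition pderiv p a : nat -> C := fun n => a (n * p)%N *+ logn p (n * p).

Lemma nrmMn (z : C) k : nrm (z *+ k) = nrm z *+ k.
Proof.
rewrite -mulr_natr -[RHS]mulr_natr nrmM (_ : k%:R = Complex k%:R 0).
  by rewrite nrm_real ger0_norm.
by rewrite -[RHS]/(real_complex R _) rmorph_nat.
Qed.

Lemma wsum_pderiv t u p a : t < u -> (0 < p)%N ->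
  exists2 K, 0 <= K & forall N, wsum u (pderiv p a) N <= K * wsum t a (N * p)%N.
Proof.
move=> tu p0; have ut : 0 < u - t by rewrite subr_gt0.
have ln2 : 0 < ln (2 : R) by rewrite ln_gt0// ltr1n.
pose K := (wt u p)^-1 * ((u - t) * ln 2)^-1.
have K0 : 0 <= K by rewrite mulr_ge0 ?invr_ge0 ?mulr_ge0 ?wt_ge0 ?ltW.
exists K => // N; rewrite mulr_sumr.
apply: (@le_trans _ _ (\sum_(1 <= n < N.+1) K * (nrm (a (n * p)%N) * wt t (n * p)))).
  rewrite /wsum big_nat [leRHS]big_nat; apply: ler_sum => n /andP[n0 _].
  rewrite /pderiv nrmMn -mulr_natr mulrCA -mulrA ler_wpM2l ?nrm_ge0//.
  have -> : wt u n = (wt u p)^-1 * (wt t (n * p) * wt (u - t) (n * p)).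
    by rewrite -wtD addrC subrK wtM// mulrC mulfK// gt_eqF ?wt_gt0.
  rewrite mulrCA /K -mulrA ler_wpM2l ?invr_ge0 ?wt_ge0// mulrCA mulrC.
  by rewrite ler_wpM2r ?wt_ge0// logn_wt// muln_gt0 n0.
rewrite (sum_multiples (fun m => K * (nrm (a m) * wt t m)))//.
rewrite big_mkcond; apply: ler_sum => m _.
case: ifP => // _; apply: mulr_ge0 => //.
by rewrite mulr_ge0 ?nrm_ge0 ?wt_ge0.
Qed.

(** The exponent is required to be strictly below the fixed rate [4] of the
    moments of the ball: this leaves room for the loss in [wsum_pderiv], which
    makes the class stable under any number of derivatives.  The entry at [0]
    is not a coefficient; it is normalised to make equality of sequences
    equality of series. *)
Definition summable_below4 : {pred nat -> C} := fun a =>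
  `[< a 0%N = 0 /\ exists t M : R, t < 4 /\ forall N, wsum t a N <= M >].

Lemma summable_zmod_closed : zmod_closed summable_below4.
Proof.
split=> [|a b /asboolP[a0 [t [M [t4 aM]]]] /asboolP[b0 [u [M' [u4 bM]]]]].
  apply/asboolP; split=> //; exists 0, 0; split=> // N.
  by rewrite /wsum big1// => n _; rewrite nrm0 mul0r.
apply/asboolP; split; first by rewrite -[LHS]/(a 0%N - b 0%N) a0 b0 subr0.
exists (Num.max t u), (M + M'); split; first by rewrite gt_max t4.
move=> N; rewrite (le_trans (wsumB _ _ _ _))// lerD//.
- by rewrite (le_trans _ (aM N))// le_wsum// le_max lexx.
- by rewrite (le_trans _ (bM N))// le_wsum// le_max lexx orbT.
Qed.

Lemma summable_conv a b : a \in summable_below4 -> b \in summable_below4 ->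
  dirichlet_conv a b \in summable_below4.
Proof.
move=> /asboolP[a0 [t [M [t4 aM]]]] /asboolP[b0 [u [M' [u4 bM]]]].
apply/asboolP; split; first exact: conv_at0.
exists (Num.max t u), (M * M'); split; first by rewrite gt_max t4.
move=> N; rewrite (le_trans (wsum_conv _ _ _ _))// ler_pM ?wsum_ge0//.
- by rewrite (le_trans _ (aM N))// le_wsum// le_max lexx.
- by rewrite (le_trans _ (bM N))// le_wsum// le_max lexx orbT.
Qed.

Lemma summable_pderiv p a : (0 < p)%N -> a \in summable_below4 ->
  pderiv p a \in summable_below4.
Proof.
move=> p0 /asboolP[a0 [t [M [t4 aM]]]].
apply/asboolP; split; first by rewrite /pderiv mul0n a0 mul0rn.
have tu : t < (t + 4) / 2 by lra.
have [K K0 aK] := wsum_pderiv a tu p0.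
exists ((t + 4) / 2), (K * M); split; first by lra.
by move=> N; rewrite (le_trans (aK N))// ler_wpM2l.
Qed.

Lemma summable_unit_seq k : (0 < k)%N -> unit_seq R k \in summable_below4.
Proof.
move=> k0; apply/asboolP; split; first by rewrite /unit_seq; case: k k0.
exists 0, 1; split=> // N; rewrite /wsum.
under eq_bigr do rewrite /wt mul0r oppr0 expR0 mulr1.
have [kN|kN] := boolP (k \in index_iota 1 N.+1).
  rewrite (bigD1_seq k) ?iota_uniq//= /unit_seq eqxx nrm1 big1 ?addr0// => n.
  by move=> /negPf ->; rewrite nrm0.
rewrite big1_seq// => n /= nN; rewrite /unit_seq; case: eqP => [nk|]; rewrite ?nrm0//.
by move: kN; rewrite -nk nN.
Qed.

End Weights.

(** * The ring of coefficient sequences and its partial derivatives *)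

Section DirichletRing.
Variable R : realType.
Local Notation C := (R[i]^o).

HB.instance Definition _ :=
  GRing.isZmodClosed.Build (nat -> C) (@summable_below4 R) (@summable_zmod_closed R).

Record dseries := DSeries {
  dcoef :> nat -> C;
  dcoefP : dcoef \in @summable_below4 R }.

HB.instance Definition _ := [isSub for dcoef].
HB.instance Definition _ := [Choice of dseries by <:].
HB.instance Definition _ := [SubChoice_isSubZmodule of dseries by <:].

Lemma dcoef0 (a : dseries) : a 0%N = 0.
Proof. by have /asboolP[] := dcoefP a. Qed.

Lemma dseries_eqP (a b : dseries) : (forall n, (0 < n)%N -> a n = b n) -> a = b.
Proof.
move=> ab; apply/val_inj/funext => -[|n]; last exact: ab.
by rewrite /= !dcoef0.
Qed.

Definition dmul (a b : dseries) := DSeries (summable_conv (dcoefP a) (dcoefP b)).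
(** The predecessor makes the monomial [k^-s] total in [k], with [0] read as [1]. *)
Definition dunit (k : nat) : dseries :=
  DSeries (summable_unit_seq R (ltn0Sn k.-1)).

Lemma dmulA : associative dmul.
Proof. by move=> a b c; apply/val_inj; exact: convA. Qed.
Lemma dmulC : commutative dmul.
Proof. by move=> a b; apply/val_inj; exact: convC. Qed.
Lemma dmul1 : left_id (dunit 1) dmul.
Proof.
move=> a; apply: dseries_eqP => n n0.
by rewrite /= conv_unit_seq// dvd1n divn1.
Qed.
Lemma dmulDl : left_distributive dmul +%R.
Proof. by move=> a b c; apply/val_inj; exact: convDl. Qed.

HB.instance Definition _ := GRing.Zmodule_isComPzRing.Build dseries
  dmulA dmulC dmul1 dmulDl.

Lemma dcoefD (a b : dseries) n : (a + b) n = a n + b n. Proof. by []. Qed.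
Lemma dcoefM (a b : dseries) n : (a * b) n = dirichlet_conv a b n. Proof. by []. Qed.
Lemma dcoef1 n : (1 : dseries) n = (n == 1%N)%:R. Proof. by []. Qed.

Lemma dunitE k n : (0 < k)%N -> dunit k n = (n == k)%:R.
Proof. by case: k. Qed.

Lemma dunitM k (a : dseries) n : (0 < k)%N -> (0 < n)%N ->
  (dunit k * a) n = if (k %| n)%N then a (n %/ k)%N else 0.
Proof. by case: k => // k _ n0; rewrite dcoefM conv_unit_seq. Qed.

Lemma dunit_mul k l : (0 < k)%N -> (0 < l)%N -> dunit k * dunit l = dunit (k * l).
Proof.
move=> k0 l0; apply: dseries_eqP => n n0.
rewrite dunitM// !dunitE ?muln_gt0 ?k0//; case: ifPn => [kn|kn].
  by rewrite -(eqn_pmul2l k0) mulnC divnK.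
by case: eqP => // nkl; move: kn; rewrite nkl dvdn_mulr.
Qed.

Section Derivation.
Variable p : nat.
Hypothesis pp : prime p.

Definition dpderiv (a : dseries) := DSeries (summable_pderiv (prime_gt0 pp) (dcoefP a)).

Lemma dpderivB : zmod_morphism dpderiv.
Proof. by move=> a b; apply/val_inj/funext => n; rewrite -[RHS]/(_ *+ _ - _ *+ _) -mulrnBl. Qed.

HB.instance Definition _ := GRing.isZmodMorphism.Build dseries dseries dpderiv dpderivB.

(** A series supported on multiples of [p] is [p^-s] times its shift. *)
Lemma conv_shift (a b : nat -> C) n : (0 < n)%N -> a 0%N = 0 ->
  (forall m, ~~ (p %| m)%N -> a m = 0) ->
  dirichlet_conv a b (n * p) = dirichlet_conv (fun m => a (m * p)%N) b n.
Proof.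
move=> n0 a0 ap; have p0 := prime_gt0 pp.
have -> : a = dirichlet_conv (unit_seq R p) (fun m => a (m * p)%N).
  apply/funext => -[|m]; first by rewrite conv_at0.
  rewrite conv_unit_seq//; case: ifPn => [pm|/ap//].
  by rewrite divnK.
rewrite -convA conv_unit_seq ?muln_gt0 ?n0// dvdn_mull// mulnK//.
congr (dirichlet_conv _ _ _); apply/funext => -[|m]; first by rewrite mul0n conv_at0.
by rewrite conv_unit_seq ?muln_gt0 ?p0// dvdn_mull// mulnK.
Qed.

(** Multiplication of the [m]-th coefficient by the [p]-adic valuation of [m] is
    a derivation, and the partial derivative is its quotient by [p^-s]. *)
Lemma dpderivM (a b : dseries) : dpderiv (a * b) = dpderiv a * b + a * dpderiv b.
Proof.
have p0 := prime_gt0 pp.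
pose th (a : nat -> C) m := a m *+ logn p m.
have thp (x : nat -> C) m : ~~ (p %| m)%N -> th x m = 0.
  by move=> pm; rewrite /th lognE (negPf pm) !andbF.
have th0 x : th x 0%N = 0 by rewrite /th logn0.
apply: dseries_eqP => n n0.
have np : (0 < n * p)%N by rewrite muln_gt0 n0.
rewrite (mulrC a (dpderiv b)) dcoefD !dcoefM /= -/(pderiv _ _).
rewrite -(@conv_shift (th a))//; last exact: thp.
rewrite -(@conv_shift (th b))//; last exact: thp.
rewrite [X in _ = _ + X](_ : _ = dirichlet_conv a (th b) (n * p)); last by rewrite convC.
rewrite /pderiv !(convE _ _ np (leqnn _)) -big_split/= -sumrMnl.
apply: eq_bigr => m _; rewrite -big_split /= -sumrMnl; apply: eq_bigr => k _.
case: eqP => [mk|_]; last by rewrite !mulr0n mul0rn addr0.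
have [m0 k0] : (0 < m)%N /\ (0 < k)%N.
  by move: np; rewrite -mk muln_gt0 => /andP.
by rewrite !mulr1n -mk lognM// mulrnDr /th mulrnAl mulrnAr.
Qed.

Lemma dpderiv_dunit k : prime k -> dpderiv (dunit k) = (p == k)%:R.
Proof.
move=> pk; apply: dseries_eqP => n n0; rewrite /= /pderiv -/(dunit k).
rewrite prednK ?prime_gt0// /unit_seq.
have [<-|npk] := eqVneq p k.
  rewrite dcoef1 -{2}(mul1n p) eqn_pmul2r ?prime_gt0//.
  by case: eqP => [->|]; rewrite ?mul0rn// mul1n logn_prime// eqxx.
case: eqP => [npE|]; last by rewrite mul0rn.
have : (p %| k)%N by rewrite -npE dvdn_mull.
by rewrite dvdn_prime2// (negPf npk).
Qed.

Lemma dpderiv_scalar (a : dseries) : (forall n, n != 1%N -> a n = 0) -> dpderiv a = 0.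
Proof.
move=> a1; apply: dseries_eqP => n n0; rewrite /= /pderiv a1 ?mul0rn//.
by rewrite muln_eq1 negb_and orbC gtn_eqF ?prime_gt1.
Qed.
End Derivation.

Lemma dpderivC p q (pp : prime p) (pq : prime q) (a : dseries) :
  dpderiv pp (dpderiv pq a) = dpderiv pq (dpderiv pp a).
Proof.
have [E|pnq] := eqVneq p q; first by case: q / E pq => pq; rewrite (bool_irrelevance pp pq).
apply: dseries_eqP => n n0; rewrite /= /pderiv mulnAC -!mulrnA; congr (_ *+ _).
rewrite !lognM ?muln_gt0 ?n0 ?prime_gt0// !(logn_prime _ pp) !(logn_prime _ pq) !eqxx.
by rewrite (negPf pnq) eq_sym (negPf pnq) !addn0 mulnC.
Qed.

End DirichletRing.

(** * Moments of the ball *)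

Section BallWeights.
Variables (R : realType) (n : nat) (P : 'I_(n + n) -> nat).
Hypothesis P_prime : forall i, prime (P i).
Hypothesis P_inj : injective P.
Implicit Types (m : nat) (j : 'I_n).

Let p j := P (lshift n j).
Let q j := P (rshift n j).
Definition pq j := (p j * q j)%N.

(** The square of the radius of the ball.  On the ball [|z_j w_j| = |z_j|^2] is
    then at most [(p_j q_j)^-4], which gives the moments the decay stated in
    [ball_moment_le]. *)
Definition radius2 : R := wt 4 (\prod_i P i).

(** The [m]-th monomial is a product of the [z_j w_j]; on the ball, where [w_j] is
    the conjugate of [z_j], the other monomials have integral zero by rotation
    invariance. *)
Definition balanced m := m == (\prod_j pq j ^ logn (p j) m)%N.

(** Up to a constant factor, the integral over the ball
    [sum_j |z_j|^2 <= radius2] of C^n of the product of the [|z_j|^(2 b_j)], where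
    [b_j] is the exponent of [p j] in [m]. *)
Definition ball_moment m : R :=
  if balanced m then
    radius2 ^+ (\sum_j logn (p j) m) * (\prod_j (logn (p j) m)`!)%:R
      / ((\sum_j logn (p j) m) + n)`!%:R
  else 0.

Let P0 i : (0 < P i)%N. Proof. exact: prime_gt0. Qed.
Let pq0 j : (0 < pq j)%N. Proof. by rewrite muln_gt0 !P0. Qed.

Let logP i k : logn (P i) (P k) = (i == k).
Proof. by rewrite logn_prime// (inj_eq P_inj). Qed.

Let logn_pq i j : logn (p i) (pq j) = (i == j).
Proof.
by rewrite lognM ?P0// !logP (inj_eq (@lshift_inj _ _)) eq_lrshift addn0.
Qed.

Let logn_pqr i j : logn (q i) (pq j) = (i == j).
Proof.
by rewrite lognM ?P0// !logP (inj_eq (@rshift_inj _ _)) eq_rlshift.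
Qed.

Lemma logn_prod_pow r (F : 'I_n -> nat) :
  logn r (\prod_j pq j ^ F j) = (\sum_j F j * logn r (pq j))%N.
Proof.
suff : (0 < \prod_j pq j ^ F j)%N /\
  logn r (\prod_j pq j ^ F j) = (\sum_j F j * logn r (pq j))%N by case.
elim/big_ind2 : _ => [|x u y v [x0 xu] [y0 yv]|j _]; first by rewrite logn1.
- by rewrite muln_gt0 x0 y0 lognM// xu yv.
- by rewrite expn_gt0 pq0 lognX.
Qed.

Lemma balanced_logn m j : balanced m -> logn (p j) m = logn (q j) m.
Proof.
move=> /eqP {2}->; rewrite logn_prod_pow (bigD1 j)//= logn_pqr eqxx muln1.
by rewrite big1 ?addn0// => i /negPf; rewrite logn_pqr eq_sym => ->; rewrite muln0.
Qed.

Lemma balanced_step m j : (0 < m)%N -> balanced (pq j * m) = balanced m.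
Proof.
move=> m0; rewrite /balanced.
have -> : (\prod_i pq i ^ logn (p i) (pq j * m) =
    pq j * \prod_i pq i ^ logn (p i) m)%N.
  under eq_bigr do rewrite lognM// logn_pq expnD.
  rewrite big_split/=; congr (_ * _)%N.
  by rewrite (bigD1 j)//= eqxx expn1 big1 ?muln1// => i /negPf ->.
by rewrite eqn_pmul2l.
Qed.

Lemma ball_moment_step m j : (0 < m)%N ->
  ball_moment (pq j * m) =
  ball_moment m * (radius2 * (logn (p j) m).+1%:R /
                   (\sum_j logn (p j) m + n).+1%:R).
Proof.
move=> m0; rewrite /ball_moment balanced_step//; case: ifP => _; last by rewrite mul0r.
have sE : (\sum_i logn (p i) (pq j * m) = (\sum_i logn (p i) m).+1)%N.
  under eq_bigr do rewrite lognM// logn_pq.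
  rewrite big_split/= -[RHS]add1n; congr (_ + _)%N.
  by rewrite (bigD1 j)//= eqxx big1// => i /negPf ->.
have fE : (\prod_i (logn (p i) (pq j * m))`! =
    (logn (p j) m).+1 * \prod_i (logn (p i) m)`!)%N.
  rewrite (bigD1 j)//= [in RHS](bigD1 j)//= lognM// logn_pq eqxx add1n factS.
  rewrite -mulnA; congr (_ * (_ * _))%N; apply: eq_bigr => i /negPf ij.
  by rewrite lognM// logn_pq ij.
rewrite sE fE addSn factS !natrM exprS.
by field; rewrite -natrD nat1r !pnatr_eq0 -!lt0n fact_gt0.
Qed.

Lemma ball_moment1 : ball_moment 1 != 0.
Proof.
rewrite /ball_moment /balanced.
rewrite [in X in if X then _ else _]big1 ?eqxx => [|j _]; last by rewrite logn1.
apply: lt0r_neq0; rewrite !mulr_gt0 ?exprn_gt0 ?wt_gt0 ?invr_gt0 ?ltr0n ?fact_gt0//.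
by apply: prodn_gt0 => j; rewrite fact_gt0.
Qed.

Lemma prod_fact_le (I : finType) (F : I -> nat) :
  (\prod_i (F i)`! <= (\sum_i F i)`!)%N.
Proof.
elim/big_ind2 : _ => // a b c e ab ce.
rewrite (leq_trans (leq_mul ab ce))//=.
by rewrite -(bin_fact (leq_addr c a)) addKn leq_pmull// bin_gt0 leq_addr.
Qed.

Lemma radius2_gt0 : 0 < radius2. Proof. exact: wt_gt0. Qed.

Lemma ball_moment_le m : (0 < m)%N -> `|ball_moment m| <= wt 4 m.
Proof.
move=> m0; rewrite /ball_moment; case: ifPn => [/eqP mE|_]; last first.
  by rewrite normr0 wt_ge0.
set s := (\sum_j _)%N; set f := (\prod_j _)%N.
have F0 : 0 < (s + n)`!%:R :> R by rewrite ltr0n fact_gt0.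
rewrite ger0_norm; last first.
  by rewrite !mulr_ge0 ?exprn_ge0 ?invr_ge0 ?ler0n ?ltW ?radius2_gt0.
rewrite -mulrA (@le_trans _ _ (radius2 ^+ s))//.
  rewrite ler_piMr//; first by rewrite exprn_ge0 ?ltW ?radius2_gt0.
  rewrite ler_pdivrMr// mul1r ler_nat.
  by rewrite (leq_trans (prod_fact_le _))// leq_fact// leq_addr.
set Q := (\prod_i P i)%N.
have Q0 : (0 < Q)%N by apply: prodn_gt0.
have -> : radius2 ^+ s = wt 4 (Q ^ s).
  elim: (s) => [|k IH]; first by rewrite expr0 expn0 /wt ln1 mulr0 oppr0 expR0.
  by rewrite exprS expnS wtM ?expn_gt0 ?Q0// IH.
rewrite /wt ler_expR lerN2 ler_wpM2l// ler_ln ?posrE ?ltr0n ?expn_gt0 ?Q0// ler_nat.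
rewrite [leqLHS]mE /s expn_sum; apply: leq_prod => j _.
case: (logn _ _) => // e; rewrite leq_exp2r//.
rewrite dvdn_leq// /Q big_split_ord dvdn_mul//.
  by rewrite (bigD1 j)//= dvdn_mulr.
by rewrite (bigD1 j)//= dvdn_mulr.
Qed.

(** The transpose of [pderiv] acting on weights. *)
Definition pderiv_weight (l : nat) (L : nat -> R) m : R :=
  if (l %| m)%N then L (m %/ l)%N *+ logn l m else 0.

(** Stokes' formula on monomials: the integral of [d_i ((c - sum_j z_j w_j) h)]
    is zero for [h] the [m]-th monomial.  If the prime [P i] divides [m], this is
    the recursion [ball_moment_step], summed over [j]; otherwise no monomial
    occurring on the right is balanced. *)
Lemma ball_moment_stokes i m : (0 < m)%N ->
  radius2 * pderiv_weight (P i) ball_moment m =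
  \sum_j pderiv_weight (P i) ball_moment (pq j * m).
Proof.
move=> m0; pose j0 := match fintype.split i with inl j => j | inr j => j end.
have iP : (P i = p j0) \/ (P i = q j0).
  rewrite /j0 -[in P i](splitK i); case: (fintype.split i) => j; by [left|right].
have logPpq j : logn (P i) (pq j) = (j == j0).
  by case: iP => ->; rewrite ?logn_pq ?logn_pqr eq_sym.
have Pim : (P i %| m)%N = (0 < logn (P i) m)%N.
  by rewrite logn_gt0 mem_primes P_prime m0.
have bal_log k : (0 < k)%N -> balanced k -> logn (P i) k = logn (p j0) k.
  by move=> k0 bk; case: iP => ->//; rewrite (balanced_logn j0 bk).
rewrite /pderiv_weight; case: ifPn => [im|im].
  pose k := (m %/ P i)%N; have mE : m = (k * P i)%N by rewrite divnK.
  have k0 : (0 < k)%N by rewrite divn_gt0// dvdn_leq.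
  have lm : logn (P i) m = (logn (P i) k).+1 by rewrite mE lognM// logP eqxx addn1.
  under eq_bigr => j _.
    rewrite dvdn_mull// -muln_divA// -/k ball_moment_step// lognM// logPpq lm.
    over.
  rewrite -/k lm.
  have [bk|bk] := boolP (balanced k); last first.
    rewrite /ball_moment (negPf bk) mul0rn mulr0 big1// => j _.
    by rewrite mul0r mul0rn.
  rewrite (bal_log _ k0 bk); set b := logn (p j0) k.
  set S := (\sum_j logn (p j) k + n)%N.
  have S0 : S.+1%:R != 0 :> R by rewrite pnatr_eq0.
  transitivity (ball_moment k * radius2 / S.+1%:R *
      (\sum_j ((logn (p j) k).+1 * ((j == j0) + b.+1))%:R)); last first.
    rewrite mulr_sumr; apply: eq_bigr => j _.
    by rewrite -[RHS]mulr_natr natrM; field.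
  rewrite -natr_sum; have -> : (\sum_j (logn (p j) k).+1 * ((j == j0) + b.+1) =
      b.+1 * S.+1)%N.
    under eq_bigr do rewrite mulnDr.
    rewrite big_split/= -big_distrl/= (bigD1 j0)//= eqxx muln1 big1 ?addn0; last first.
      by move=> j /negPf ->; rewrite muln0.
    under eq_bigr do rewrite -addn1.
    by rewrite big_split/= sum1_card card_ord -/S [RHS]mulnS mulnC.
  by rewrite natrM -mulr_natr; field.
rewrite mulr0 big1// => j _; case: ifPn => // ijm.
have m_log : logn (P i) m = 0%N by move: im; rewrite Pim -eqn0Ngt => /eqP.
have jj0 : j = j0.
  apply/eqP; have : (0 < logn (P i) (pq j * m))%N.
    by rewrite logn_gt0 mem_primes P_prime muln_gt0 pq0 m0.
  by rewrite lognM// m_log addn0 logPpq lt0b.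
rewrite jj0 in ijm *.
set k := (_ %/ _)%N; have kE : (k * P i = pq j0 * m)%N by rewrite divnK.
have k0 : (0 < k)%N by rewrite divn_gt0// dvdn_leq// muln_gt0 pq0.
have ki : logn (P i) k = 0%N.
  have := congr1 (logn (P i)) kE; rewrite (lognM _ k0 (P0 i)) (lognM _ (pq0 _) m0) logPpq logP !eqxx m_log; lia.
rewrite /ball_moment; case: ifPn => [bk|]; last by rewrite mul0rn.
have pk : logn (p j0) k = 0%N by rewrite -(bal_log _ k0 bk).
have qk : logn (q j0) k = 0%N by rewrite -(balanced_logn j0 bk).
have k' r : (logn r k + logn r (P i) = logn r (pq j0) + logn r m)%N.
  by rewrite -lognM// kE lognM.
move: (k' (p j0)) (k' (q j0)); rewrite pk qk logn_pq logn_pqr eqxx.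
by case: iP => ->; rewrite !logP ?eqxx ?eq_lrshift ?eq_rlshift.
Qed.
End BallWeights.

(** * Integration over the ball *)

Section Pairing.
Variables (R : realType) (L : nat -> R).
Local Notation C := (R[i]^o).
Hypothesis L_le : forall m, (0 < m)%N -> `|L m| <= wt 4 m.

Definition pairing_term (a : nat -> C) m : R := complex.Re (a m) * L m.

(** The integral over the ball, when [L] is the sequence of its moments.  Taking
    real parts keeps it additive, which is all that is needed. *)
Definition pairing (a : dseries R) : R := limn (series (pairing_term a)).

Lemma is_cvg_pairing (a : dseries R) : cvgn (series (pairing_term a)).
Proof.
apply: normed_cvg; apply: nondecreasing_is_cvgn.
  by apply: nondecreasing_series => k _ _; exact: normr_ge0.
have /asboolP[a0 [t [M [t4 aM]]]] := dcoefP a.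
exists M => _ [N _ <-]; apply: le_trans (aM N); rewrite /series /=.
rewrite /wsum (@le_trans _ _ (\sum_(0 <= k < N.+1) `|pairing_term a k|))//.
  by rewrite big_nat_recr//= lerDl.
rewrite big_ltn// /pairing_term a0 /= mul0r normr0 add0r.
rewrite big_nat [leRHS]big_nat; apply: ler_sum => m /andP[m0 _].
rewrite normrM ler_pM ?Re_le_nrm// (le_trans (L_le m0))// le_wt// ltW//.
Qed.

Lemma pairing_cvg (a : dseries R) :
  (fun N => \sum_(1 <= m < N.+1) pairing_term a m) @ \oo --> pairing a.
Proof.
have : series (pairing_term a) @ \oo --> pairing a by exact: is_cvg_pairing.
rewrite -(cvg_shiftS (series (pairing_term a))); apply: cvg_trans.
rewrite (_ : (fun N => _) = (fun N => series (pairing_term a) N.+1))//.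
apply/funext => N; rewrite /series /= [RHS]big_ltn//.
by rewrite /pairing_term dcoef0 /= mul0r add0r.
Qed.

Lemma pairingB : zmod_morphism pairing.
Proof.
move=> a b; apply/cvg_lim => //.
rewrite (_ : series _ = series (pairing_term a) \- series (pairing_term b)).
  by apply: cvgB; exact: is_cvg_pairing.
apply/funext => N; rewrite /series /= -sumrB; apply: eq_bigr => m _.
by rewrite /pairing_term raddfB mulrBl.
Qed.

HB.instance Definition _ := GRing.isZmodMorphism.Build (dseries R) R pairing pairingB.

Definition pairing_additive : {additive dseries R -> R} := pairing.

Lemma pairing1 : pairing 1 = L 1.
Proof.
rewrite -(cvg_lim (@Rhausdorff R) (@pairing_cvg 1)); apply/cvg_lim => //.
apply: cvg_near_cst; exists 1%N => // N /= N1.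
rewrite big_ltn ?ltnS// big1_seq /pairing_term ?dcoef1 /= ?mul1r ?addr0//.
move=> m /=; rewrite mem_index_iota => /andP[m1 _].
by rewrite /unit_seq gtn_eqF// mul0r.
Qed.

(** Both sides are limits of partial sums, cut at different places: the
    derivative shifts indices by [p] and the monomial by [k], so the partial
    sum of length [N * k] on the right-hand side is the one of length [N * p] of
    the transposed sum. *)
Lemma pairing_dpderiv_dunitM p (pp : prime p) k (h : dseries R) : (0 < k)%N ->
  (fun N => \sum_(1 <= m < (N * p).+1) complex.Re (h m) * pderiv_weight p L (k * m))
    @ \oo --> pairing (dpderiv pp (dunit R k * h)).
Proof.
move=> k0; pose b := dunit R k * h.
have kN := cvg_mulnr _ k0.
have := cvg_comp _ _ kN (@pairing_cvg (dpderiv pp b)); apply: cvg_trans.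
rewrite (_ : (fun N => _) = (fun N => \sum_(1 <= m < N.+1)
  pairing_term (dpderiv pp b) m) \o (fun N => N * k)%N)//.
apply/funext => N; rewrite /=.
have p0 := prime_gt0 pp.
pose H m := complex.Re (b m) * pderiv_weight p L m.
transitivity (\sum_(1 <= m < (N * p * k).+1 | (p %| m)%N) H m); last first.
  rewrite mulnAC -sum_multiples//; apply: eq_bigr => m _.
  rewrite /H /pderiv_weight dvdn_mull// mulnK// /pairing_term /= /pderiv.
  by rewrite -/(b _) raddfMn /= mulrnAl mulrnAr.
transitivity (\sum_(1 <= m < (N * p * k).+1 | (k %| m)%N) H m).
  rewrite -sum_multiples//; apply: eq_big_nat => m /andP[m0 _].
  by rewrite /H dunitM ?muln_gt0 ?m0// dvdn_mull// mulnK// mulnC.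
rewrite big_mkcond [RHS]big_mkcond; apply: eq_big_nat => m /andP[m0 _].
rewrite /H /pderiv_weight; case: (p %| m)%N; last by rewrite mulr0 if_same.
by case: ifPn => // km; rewrite dunitM// (negPf km) /= mul0r.
Qed.
End Pairing.

Section Stokes.
Variables (R : realType) (n : nat) (P : 'I_(n + n) -> nat).
Local Notation C := (R[i]^o).
Hypothesis P_prime : forall i, prime (P i).
Hypothesis P_inj : injective P.

Lemma summable_cst (x : C) :
  (fun m => if m == 1%N then x else 0) \in @summable_below4 R.
Proof.
apply/asboolP; split=> //; exists 0, (nrm x); split=> // -[|N]; rewrite /wsum.
  by rewrite big_geq ?nrm_ge0.
rewrite big_ltn// eqxx /wt ln1 mulr0 oppr0 expR0 mulr1 big1_seq ?addr0// => m /=.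
by rewrite mem_index_iota => /andP[m1 _]; rewrite gtn_eqF// nrm0 mul0r.
Qed.

Definition dcst (x : C) := DSeries (summable_cst x).

Lemma dcstE x m : dcst x m = if m == 1%N then x else 0. Proof. by []. Qed.

Lemma dcstM x (a : dseries R) m : (0 < m)%N -> (dcst x * a) m = x * a m.
Proof.
move=> m0; have -> : (dcst x * a) m = x * (1 * a) m; last by rewrite mul1r.
rewrite !dcoefM /dirichlet_conv mulr_sumr; apply: eq_bigr => i _.
rewrite mulr_sumr; apply: eq_bigr => j _; rewrite dcstE dcoef1.
by case: eqP => _; rewrite ?mulr1 ?mul1r// !(mul0r, mulr0).
Qed.

Let L := @ball_moment R n P.
Let r2 := @radius2 R n P.
Let r2C : C := Complex r2 0.
Let z (j : 'I_n) := dunit R (P (lshift n j)).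
Let w (j : 'I_n) := dunit R (P (rshift n j)).

Let L_le m : (0 < m)%N -> `|L m| <= wt 4 m.
Proof. exact: ball_moment_le. Qed.

Definition sphere_series : dseries R := dcst r2C - \sum_j z j * w j.

(** [ball_moment_stokes], extended from monomials to all series. *)
Lemma ball_stokes i h : pairing L (dpderiv (P_prime i) (sphere_series * h)) = 0.
Proof.
rewrite /sphere_series.
have zw j : z j * w j = dunit R (pq P j) by rewrite dunit_mul ?prime_gt0.
under eq_bigr do rewrite zw.
have D1 := @pairing_dpderiv_dunitM _ _ L_le _ (P_prime i) 1 h isT.
have Dj (j : 'I_n) : (0 < pq P j)%N by rewrite muln_gt0 !prime_gt0.
have D2 j := @pairing_dpderiv_dunitM _ _ L_le _ (P_prime i) _ h (Dj j).
rewrite -[LHS]/(pairing_additive L_le _).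
rewrite mulrBl mulr_suml !raddfB !raddf_sum /=.
have -> : pairing L (dpderiv (P_prime i) (dcst r2C * h)) =
    r2 * pairing L (dpderiv (P_prime i) (dunit R 1 * h)).
  apply/cvg_lim => //.
  rewrite (_ : series _ = (fun N => r2 * series (pairing_term L
      (dpderiv (P_prime i) (dunit R 1 * h))) N)).
    by apply: cvgMl_tmp; exact: is_cvg_pairing.
  apply/funext => N; rewrite /series /= mulr_sumr.
  apply: eq_bigr => -[|m] _; first by rewrite /pairing_term
    /pderiv mul0n !conv_at0 !mul0rn /= !mul0r mulr0.
  rewrite /pairing_term /pderiv.
  rewrite -[dirichlet_conv (fun m => _) _ _]/((dcst r2C * h) _).
  rewrite -[dirichlet_conv (unit_seq R 1) _ _]/((1 * h) _) mul1r.
  rewrite dcstM; last by rewrite muln_gt0 (prime_gt0 (P_prime i)).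
  have ReMn (x : C) k : complex.Re (x *+ k) = complex.Re x *+ k by exact: raddfMn.
  rewrite !ReMn; case: (h _) => x y /=.
  by rewrite mul0r subr0 -mulrnAr mulrA.
apply/eqP; rewrite sumrN subr_eq0; apply/eqP.
have S1 := @cvgMl_tmp _ _ _ eventually_filter _ r2 _ D1.
have S2 : (fun N => \sum_j \sum_(1 <= m < (N * P i).+1)
    complex.Re (h m) * pderiv_weight (P i) L (pq P j * m)) @ \oo -->
    \sum_j pairing L (dpderiv (P_prime i) (dunit R (pq P j) * h)).
  by apply: cvg_big => [|j _]; [exact: add_continuous|exact: D2].
rewrite -(cvg_lim (@Rhausdorff R) S1) -(cvg_lim (@Rhausdorff R) S2).
congr (limn _); apply/funext => N /=.
rewrite exchange_big mulr_sumr; apply: eq_big_nat => m /andP[m0 _].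
by rewrite mul1n mulrCA -mulr_sumr -(ball_moment_stokes R P_prime P_inj i m0).
Qed.
End Stokes.

Lemma dseries_no_unimodular_perturbation (R : realType) n (P : 'I_(n + n) -> nat)
    (x b : 'I_n -> dseries R) : (forall i, prime (P i)) -> injective P ->
  \sum_j b j * (dunit R (P (lshift n j)) + x j * sphere_series R P) = 1 -> False.
Proof.
move=> P_prime P_inj.
have L_le := @ball_moment_le R n P P_prime.
apply: (@no_unimodular_perturbation (dseries R) n
  (fun i => dpderiv (P_prime i)) _ _ R (pairing_additive L_le) (fun i => dunit R (P i))).
- by move=> i a c; exact: dpderivM.
- by move=> i j a; exact: dpderivC.
- move=> i j; rewrite -(inj_eq P_inj); exact: dpderiv_dunit (P_prime j).
- by move=> i; apply: dpderiv_scalar => m /negPf m1; rewrite dcstE m1.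
- by move=> i h; exact: ball_stokes.
- by rewrite /= pairing1// ball_moment1.
Qed.

(** * Integrals of continuous functions on segments *)

Section SegmentIntegral.
Variable R : realType.
Implicit Types (f g : R -> R) (a b c : R).
Local Notation mu := (@lebesgue_measure R).

Definition seg_int f a b : R := \int[mu]_(x in `[a, b]) f x.
Definition cont_on f a b := {in `[a, b], continuous f}.

Lemma cont_on_integrable f a b : cont_on f a b -> mu.-integrable `[a, b] (EFin \o f).
Proof.
move=> cf; apply: continuous_compact_integrable; first exact: segment_compact.
by apply: continuous_in_subspaceT => x /set_mem; exact: cf.
Qed.

Lemma cont_onB f g a b : cont_on f a b -> cont_on g a b ->
  cont_on (fun x => f x - g x) a b.
Proof. by move=> cf cg x xab; apply: cvgB; [exact: cf|exact: cg]. Qed.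

Lemma cont_onD f g a b : cont_on f a b -> cont_on g a b ->
  cont_on (fun x => f x + g x) a b.
Proof. by move=> cf cg x xab; apply: cvgD; [exact: cf|exact: cg]. Qed.

Lemma eq_seg_int f g a b : {in `[a, b], f =1 g} -> seg_int f a b = seg_int g a b.
Proof. by move=> fg; apply: eq_Rintegral => x /set_mem; exact: fg. Qed.

Lemma seg_intB f g a b : cont_on f a b -> cont_on g a b ->
  seg_int (fun x => f x - g x) a b = seg_int f a b - seg_int g a b.
Proof. by move=> cf cg; apply: RintegralB => //; exact: cont_on_integrable. Qed.

Lemma seg_intD f g a b : cont_on f a b -> cont_on g a b ->
  seg_int (fun x => f x + g x) a b = seg_int f a b + seg_int g a b.
Proof. by move=> cf cg; apply: RintegralD => //; exact: cont_on_integrable. Qed.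

Lemma seg_int_cst k a b : a <= b -> seg_int (fun=> k) a b = k * (b - a).
Proof.
move=> ab; rewrite /seg_int Rintegral_cst//= lebesgue_measure_itv/= lte_fin.
case: (ltP a b) => [//|ba]; have -> : b = a by apply/le_anti; rewrite ab ba.
by rewrite subrr.
Qed.

Lemma seg_int_cat f a c b : a <= c -> c <= b -> cont_on f a b ->
  seg_int f a b = seg_int f a c + seg_int f c b.
Proof.
move=> ac cb cf; apply/eqP; rewrite addrC -subr_eq; apply/eqP.
rewrite /seg_int Rintegral_itvB ?bnd_simp//; last exact: cont_on_integrable.
rewrite Rintegral_itv_obnd_cbnd//.
apply: (integrableS _ _ _ (cont_on_integrable cf)) => //.
by apply: subset_itv; rewrite bnd_simp ?ac ?cb.
Qed.

Lemma le_seg_int f g a b : cont_on f a b -> cont_on g a b ->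
  (forall x, a <= x <= b -> f x <= g x) -> seg_int f a b <= seg_int g a b.
Proof.
by move=> cf cg fg; apply: le_Rintegral => //; exact: cont_on_integrable.
Qed.

Lemma cont_on_cst k a b : cont_on (fun=> k) a b.
Proof. by move=> x _; exact: cvg_cst. Qed.

Lemma seg_int_bound f a b M : a <= b -> cont_on f a b ->
  (forall x, a <= x <= b -> `|f x| <= M) -> `|seg_int f a b| <= M * (b - a).
Proof.
move=> ab cf fM; rewrite ler_norml -mulNr -!seg_int_cst//.
rewrite !le_seg_int//; try exact: cont_on_cst.
- by move=> x /fM; rewrite ler_norml => /andP[].
- by move=> x /fM; rewrite ler_norml => /andP[].
Qed.

Lemma cont_on_sum (I : eqType) (r : seq I) (F : I -> R -> R) a b :
  (forall i, i \in r -> cont_on (F i) a b) -> cont_on (fun x => \sum_(i <- r) F i x) a b.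
Proof.
elim: r => [|i r IH] cF.
  by under eq_fun do rewrite big_nil; exact: cont_on_cst.
under eq_fun do rewrite big_cons; apply: cont_onD.
  by apply: cF; rewrite mem_head.
by apply: IH => j jr; apply: cF; rewrite inE jr orbT.
Qed.

Lemma seg_int_derive f g a b : a <= b ->
  (forall x : R, is_derive x (1 : R) g (f x)) -> (forall x, {for x, continuous f}) ->
  seg_int f a b = g b - g a.
Proof.
move=> ab dg cf; have [ab'|ba|->] := ltgtP a b; last 2 first.
- by move: ab; rewrite leNgt ba.
- by rewrite subrr /seg_int set_itv1 Rintegral_set1.
have cg x : {for x, continuous g}.
  by apply: differentiable_continuous; apply/derivable1_diffP; exact: ex_derive.
rewrite /seg_int /Rintegral (@continuous_FTC2 _ f g)//.
- by apply: continuous_subspaceT => x; exact: cf.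
- split.
  + by move=> x _; exact: ex_derive.
  + by apply: cvg_at_right_filter; exact: cg.
  + by apply: cvg_at_left_filter; exact: cg.
- by move=> x _; rewrite derive1E; exact: derive_val.
Qed.

End SegmentIntegral.

(** * Complex differentiability and Cauchy's theorem for rectangles *)

Section ComplexDifferentiability.
Variable R : realType.
Local Notation C := (R[i]^o).
Implicit Types (F : C -> C) (z w : C) (e : R).

(** Derivability along [1] over the complex numbers, with real epsilon and
    delta. *)
Definition cdiff F z := exists b : C, forall e, 0 < e -> exists2 d : R, 0 < d &
  forall w, nrm (w - z) < d -> nrm (F w - F z - b * (w - z)) <= e * nrm (w - z).

Lemma ler_nrm (z : C) e : (`|z| <= Complex e 0) = (nrm z <= e).
Proof. by rewrite normE lec_complexr. Qed.

Lemma ltr_nrm (z : C) e : (`|z| < Complex e 0) = (nrm z < e).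
Proof. by rewrite normE ltc_complexr. Qed.

Lemma nrm_eq0 (z : C) : (nrm z == 0) = (z == 0).
Proof. by rewrite -[RHS]normr_eq0 normE eq_complex /= eqxx andbT. Qed.

Lemma nrm_gt0 (z : C) : (0 < nrm z) = (z != 0).
Proof. by rewrite lt_neqAle nrm_ge0 andbT eq_sym nrm_eq0. Qed.

Lemma nrmV (z : C) : nrm z^-1 = (nrm z)^-1.
Proof.
have [->|z0] := eqVneq z 0; first by rewrite !(invr0, nrm0).
apply: (mulfI (x := nrm z)); first by rewrite nrm_eq0.
by rewrite -nrmM !divff ?nrm1// nrm_eq0.
Qed.

Lemma derivable_cdiff F z : derivable F z 1 <-> cdiff F z.
Proof.
split=> [dF|[b Fb]].
  exists ('D_1 F z) => e e0.
  have e0' : 0 < Complex e 0 :> C by rewrite (_ : 0 = Complex 0 0)// ltc_complexr.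
  have /cvgrPdist_le/(_ _ e0') := dF.
  rewrite near_withinE => /nbhs_ballP[d /= d0 dle].
  have [rd dE] := gt0_complexr d0; exists (complex.Re d) => // w wd.
  have [->|wz] := eqVneq w z; first by rewrite !subrr mulr0 subrr nrm0 mulr0.
  have wz0 : w - z != 0 by rewrite subr_eq0.
  have := dle (w - z); rewrite /ball /= sub0r normrN dE ltr_nrm => /(_ wd wz0).
  rewrite -[_ *: 1]/((w - z) * 1) mulr1 subrK ler_nrm -[_^-1 *: _]/((w - z)^-1 * _).
  rewrite -(ler_pM2r (_ : 0 < nrm (w - z))) ?nrm_gt0// -nrmM mulrBl -mulrA mulrCA.
  by rewrite mulVf// mulr1 -nrmN opprB.
apply/cvg_ex; exists b; apply/cvgrPdist_le => e0 /gt0_complexr[e e0E].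
set e' := complex.Re e0 in e e0E; have [d d0 dle] := Fb _ e.
rewrite near_withinE; apply/nbhs_ballP; exists (Complex d 0) => /=.
  by rewrite (_ : 0 = Complex 0 0)// ltc_complexr.
move=> h; rewrite /ball /= sub0r normrN ltr_nrm => hd h0.
rewrite -[_ *: 1]/(h * 1) mulr1 -[_^-1 *: _]/(h^-1 * _) e0E ler_nrm.
have := dle (h + z); rewrite addrK => /(_ hd).
rewrite -[_ - b * h]opprK opprB nrmN => hle.
have -> : b - h^-1 * (F (h + z) - F z) = h^-1 * (b * h - (F (h + z) - F z)).
  by rewrite [RHS]mulrBr mulrCA mulVf// mulr1.
by rewrite nrmM nrmV mulrC ler_pdivrMr ?nrm_gt0.
Qed.

Lemma cdiff_near F z e : cdiff F z -> 0 < e -> exists2 d : R, 0 < d &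
  forall w, nrm (w - z) < d -> nrm (F w - F z) <= e.
Proof.
move=> [b Fb] e0; have [d d0 dle] := Fb 1 ltr01.
have b1 : 0 < 1 + nrm b by rewrite ltr_wpDr ?nrm_ge0.
exists (Num.min d (e / (1 + nrm b))); first by rewrite lt_min d0 divr_gt0.
move=> w; rewrite lt_min => /andP[wd we].
have -> : F w - F z = (F w - F z - b * (w - z)) + b * (w - z) by rewrite subrK.
rewrite (le_trans (nrmD _ _))// (le_trans (lerD (dle _ wd) (lexx _)))//.
by rewrite nrmM -mulrDl mulrC -ler_pdivlMr// ltW.
Qed.

Lemma nrm_vertical (x t s : R) : nrm (Complex x t - Complex x s) = `|t - s|.
Proof.
by rewrite -[_ - _]/(Complex (x - x) (t - s)) subrr nrmE /= expr0n add0r sqrtr_sqr.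
Qed.

Lemma nrm_horizontal (y t s : R) : nrm (Complex t y - Complex s y) = `|t - s|.
Proof.
by rewrite -[_ - _]/(Complex (t - s) (y - y)) subrr nrmE /= expr0n addr0 sqrtr_sqr.
Qed.

(** Restrictions to vertical and to horizontal lines of the real and of the
    imaginary part are instances, with [g] the line and [p] the part. *)
Lemma cdiff_continuous (g : R -> C) (p : C -> R) F (t : R) :
  (forall s, nrm (g t - g s) = `|t - s|) ->
  (forall x y, p (x - y) = p x - p y) -> (forall x, `|p x| <= nrm x) ->
  cdiff F (g t) -> {for t, continuous (fun s => p (F (g s)))}.
Proof.
move=> gd pB pn dF; apply/cvgrPdist_le => e e0.
have [d d0 dle] := cdiff_near dF e0.
apply/nbhs_ballP; exists d => // s /=; rewrite /ball /= => ts.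
rewrite -pB (le_trans (pn _))// -nrmN opprB dle//.
by rewrite -nrmN opprB gd.
Qed.

Lemma cont_vertical_Im F x a b : (forall t, cdiff F (Complex x t)) ->
  cont_on (fun t => complex.Im (F (Complex x t))) a b.
Proof.
move=> dF t _; apply: (@cdiff_continuous (Complex x) (@complex.Im R)) => //.
- by move=> s; exact: nrm_vertical.
- by move=> [? ?] [? ?].
- exact: Im_le_nrm.
Qed.

Lemma cont_horizontal_Re F y a b : (forall t, a <= t <= b -> cdiff F (Complex t y)) ->
  cont_on (fun t => complex.Re (F (Complex t y))) a b.
Proof.
move=> dF t; rewrite in_itv /= => tab.
apply: (@cdiff_continuous (fun t => Complex t y) (@complex.Re R)) => //.
- by move=> s; exact: nrm_horizontal.
- by move=> [? ?] [? ?].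
- exact: Re_le_nrm.
- exact: dF.
Qed.

End ComplexDifferentiability.

Section Goursat.
Variable R : realType.
Local Notation C := (R[i]^o).
Variable F : C -> C.
Hypothesis dF : forall z, 0 < complex.Re z -> cdiff F z.

(** The real part of the integral of [G] along the boundary of the rectangle
    with lower left corner [x + iy] and sides [a] and [b]. *)
Definition rect_int (G : C -> C) (x y a b : R) : R :=
  seg_int (fun t => complex.Re (G (Complex t y)) - complex.Re (G (Complex t (y + b)))) x (x + a)
  - seg_int (fun t => complex.Im (G (Complex (x + a) t)) - complex.Im (G (Complex x t))) y (y + b).

Let cH y x a : 0 < x ->
  cont_on (fun t => complex.Re (F (Complex t y))) x (x + a).
Proof.
move=> x0; apply: cont_horizontal_Re => t /andP[xt _]; apply: dF.
exact: lt_le_trans xt.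
Qed.

Let cV x y b : 0 < x -> cont_on (fun t => complex.Im (F (Complex x t))) y b.
Proof. by move=> x0; apply: cont_vertical_Im => t; exact: dF. Qed.

Lemma rect_int_splitx x y a b : 0 < x -> 0 <= a -> 0 <= b ->
  rect_int F x y a b = rect_int F x y (a / 2) b + rect_int F (x + a / 2) y (a / 2) b.
Proof.
move=> x0 a0 b0; have a2 : 0 <= a / 2 by rewrite divr_ge0.
have xa : 0 < x + a / 2 by rewrite ltr_wpDr.
have aE : x + a / 2 + a / 2 = x + a by rewrite -addrA -splitr.
have xa' : 0 < x + a by rewrite ltr_wpDr.
rewrite /rect_int aE (@seg_int_cat _ _ x (x + a / 2)); last 3 first.
- by rewrite lerDl.
- by rewrite -aE lerDl.
- by apply: cont_onB; exact: cH.
rewrite !(@seg_intB _ _ _ y); try exact: cV.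
by ring.
Qed.

Lemma rect_int_splity x y a b : 0 < x -> 0 <= a -> 0 <= b ->
  rect_int F x y a b = rect_int F x y a (b / 2) + rect_int F x (y + b / 2) a (b / 2).
Proof.
move=> x0 a0 b0; have b2 : 0 <= b / 2 by rewrite divr_ge0.
have xa : 0 < x + a by rewrite ltr_wpDr.
have bE : y + b / 2 + b / 2 = y + b by rewrite -addrA -splitr.
rewrite /rect_int bE (@seg_int_cat _ _ y (y + b / 2)); last 3 first.
- by rewrite lerDl.
- by rewrite -bE lerDl.
- by apply: cont_onB; exact: cV.
rewrite !(@seg_intB _ _ _ x); try exact: cH.
by ring.
Qed.

(** Cutting in halves twice, one of the four quarters carries at least a
    quarter of the integral. *)
Lemma rect_int_quarter x y a b : 0 < x -> 0 <= a -> 0 <= b ->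
  exists p : R * R, [/\ x <= p.1 <= x + a / 2, y <= p.2 <= y + b / 2 &
    `|rect_int F x y a b| <= 4 * `|rect_int F p.1 p.2 (a / 2) (b / 2)|].
Proof.
have half (u v w : R) : u = v + w -> `|u| <= 2 * `|v| \/ `|u| <= 2 * `|w|.
  move=> ->; have := ler_normD v w.
  by case: (leP `|v| `|w|) => vw uvw; [right|left]; lra.
move=> x0 a0 b0; have a2 : 0 <= a / 2 by rewrite divr_ge0.
have b2 : 0 <= b / 2 by rewrite divr_ge0.
have [x' [xx' x'a Hx]] : exists x', [/\ x <= x', x' <= x + a / 2 &
    `|rect_int F x y a b| <= 2 * `|rect_int F x' y (a / 2) b|].
  have [H|H] := half _ _ _ (rect_int_splitx y x0 a0 b0).
    by exists x; rewrite lexx lerDl.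
  by exists (x + a / 2); rewrite lexx lerDl.
have x'0 : 0 < x' by apply: lt_le_trans xx'.
have [H|H] := half _ _ _ (rect_int_splity y x'0 a2 b0).
  by exists (x', y); rewrite /= xx' x'a lexx lerDl b2; split=> //; lra.
by exists (x', y + b / 2); rewrite /= xx' x'a lexx lerDl b2; split=> //; lra.
Qed.

(** An affine function has integral zero along a rectangle, so that only the
    remainder counts; its contribution is at most its size times the
    perimeter. *)
Lemma rect_int_affine_bound (z al be : C) x y a b e :
  0 < x -> 0 <= a -> 0 <= b ->
  (forall s t, x <= s <= x + a -> y <= t <= y + b ->
    nrm (F (Complex s t) - al - be * (Complex s t - z)) <= e) ->
  `|rect_int F x y a b| <= 2 * e * (a + b).
Proof.
move=> x0 a0 b0 Fe.
have xa : 0 < x + a by rewrite ltr_wpDr.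
pose G s t : C := F (Complex s t) - al - be * (Complex s t - z).
have FG s t : F (Complex s t) = G s t + (al + be * (Complex s t - z)).
  by rewrite /G; ring.
have xl : x <= x + a by rewrite lerDl. have yl : y <= y + b by rewrite lerDl.
have ReFB s : complex.Re (F (Complex s y)) - complex.Re (F (Complex s (y + b))) =
   (complex.Re (G s y) - complex.Re (G s (y + b))) + complex.Im be * b.
  rewrite !FG; case: (G s y) => ? ?; case: (G s (y + b)) => ? ?.
  by case: z {FG Fe G} => ? ?; case: al => ? ?; case: be => ? ? /=; ring.
have ImFB t : complex.Im (F (Complex (x + a) t)) - complex.Im (F (Complex x t)) =
   (complex.Im (G (x + a) t) - complex.Im (G x t)) + complex.Im be * a.
  rewrite !FG; case: (G x t) => ? ?; case: (G (x + a) t) => ? ?.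
  by case: z {FG Fe G ReFB} => ? ?; case: al => ? ?; case: be => ? ? /=; ring.
pose f s := (complex.Re (F (Complex s y)) - complex.Re (F (Complex s (y + b)))).
pose g t := complex.Im (F (Complex (x + a) t)) - complex.Im (F (Complex x t)).
have cf : cont_on f x (x + a) by apply: cont_onB; exact: cH.
have cg : cont_on g y (y + b) by apply: cont_onB; exact: cV.
have -> : rect_int F x y a b =
    seg_int (fun s => f s - complex.Im be * b) x (x + a)
    - seg_int (fun t => g t - complex.Im be * a) y (y + b).
  rewrite (seg_intB cf (@cont_on_cst _ _ _ _)) (seg_intB cg (@cont_on_cst _ _ _ _)).
  by rewrite !seg_int_cst// /rect_int -/f -/g; ring.
rewrite (le_trans (ler_normB _ _))// mulrDr lerD//.
  have -> : 2 * e * a = 2 * e * (x + a - x) by rewrite addrC addKr.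
  apply: seg_int_bound => //; first by apply: cont_onB => //; exact: cont_on_cst.
  move=> s sa; rewrite /f ReFB addrK (le_trans (ler_normB _ _))//.
  rewrite mulr_natl mulr2n lerD// (le_trans (Re_le_nrm _))//; apply: Fe => //.
    by rewrite lexx.
  by rewrite lexx andbT.
have -> : 2 * e * b = 2 * e * (y + b - y) by rewrite addrC addKr.
apply: seg_int_bound => //; first by apply: cont_onB => //; exact: cont_on_cst.
move=> s sa; rewrite /g ImFB addrK (le_trans (ler_normB _ _))//.
rewrite mulr_natl mulr2n lerD// (le_trans (Im_le_nrm _))//; apply: Fe => //.
  by rewrite lexx andbT.
by rewrite lexx.
Qed.

Lemma halving_limit (x : nat -> R) a : 0 <= a ->
  (forall k, x k <= x k.+1 <= x k + a / 2 ^+ k / 2) ->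
  exists l, forall k, x k <= l <= x k + a / 2 ^+ k.
Proof.
move=> a0 xS.
have xadd k m : x (k + m)%N <= x k + a / 2 ^+ k - a / 2 ^+ (k + m).
  elim: m => [|m IH]; first by rewrite addn0 addrK.
  have /andP[_] := xS (k + m)%N; rewrite addnS exprS invfM; lra.
have xmono k m : x k <= x (k + m)%N.
  elim: m => [|m IH]; first by rewrite addn0.
  by rewrite addnS (le_trans IH)//; have /andP[] := xS (k + m)%N.
have xub k m : x m <= x k + a / 2 ^+ k.
  have P j : 0 <= a / 2 ^+ j by rewrite divr_ge0 ?exprn_ge0.
  have [km|mk] := leqP k m.
    rewrite -(subnKC km); have := xadd k (m - k)%N; have := P (k + (m - k))%N; lra.
  rewrite -(subnKC (ltnW mk)); have := xmono m (k - m)%N; have := P (m + (k - m))%N; lra.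
have ub k : ubound (range x) (x k + a / 2 ^+ k) by move=> _ [m _ <-].
have hs : has_sup (range x).
  by split; [exists (x 0%N), 0%N|exists (x 0%N + a / 2 ^+ 0)].
exists (sup (range x)) => k; apply/andP; split.
  by apply: sup_upper_bound => //; exists k.
by apply: sup_le_ub => //; exists (x 0%N), 0%N.
Qed.

(** Goursat's argument: among nested quarters [c k] of the rectangle, the integral
    decreases at most like [4^-k]; complex differentiability at their common
    point makes it [o(4^-k)]. *)
Lemma goursat_rectangle x y a b : 0 < x -> 0 <= a -> 0 <= b ->
  rect_int F x y a b = 0.
Proof.
move=> x0 a0 b0.
pose A k := a / 2 ^+ k. pose B k := b / 2 ^+ k.
have A0 k : 0 <= A k by rewrite divr_ge0 ?exprn_ge0.
have B0 k : 0 <= B k by rewrite divr_ge0 ?exprn_ge0.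
have step (q : nat * (R * R)) : {p : R * R | 0 < q.2.1 ->
    [/\ q.2.1 <= p.1 <= q.2.1 + A q.1 / 2, q.2.2 <= p.2 <= q.2.2 + B q.1 / 2 &
    `|rect_int F q.2.1 q.2.2 (A q.1) (B q.1)| <=
      4 * `|rect_int F p.1 p.2 (A q.1 / 2) (B q.1 / 2)|]}.
  apply: cid; have [q0|q0] := pselect (0 < q.2.1); last by exists (0, 0).
  by have [p pP] := rect_int_quarter q.2.2 q0 (A0 q.1) (B0 q.1); exists p.
pose c := fix c k := if k is k'.+1 then sval (step (k', c k')) else (x, y).
have cS k : 0 < (c k).1 -> _ := svalP (step (k, c k)).
have c0 k : 0 < (c k).1.
  elim: k => //= k IH; have [/andP[H _] _ _] := cS _ IH.
  exact: lt_le_trans H.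
have AS k : A k.+1 = A k / 2 by rewrite /A exprS invfM; ring.
have BS k : B k.+1 = B k / 2 by rewrite /B exprS invfM; ring.
have J k : `|rect_int F x y a b| <= 4 ^+ k * `|rect_int F (c k).1 (c k).2 (A k) (B k)|.
  elim: k => [|k IH]; first by rewrite expr0 mul1r /A /B !expr0 !divr1.
  rewrite (le_trans IH)// exprSr -mulrA ler_wpM2l ?exprn_ge0//.
  by rewrite AS BS; have [] := cS k (c0 k).
have [X XP] : exists X, forall k, (c k).1 <= X <= (c k).1 + A k.
  by apply: (halving_limit a0) => k; have [] := cS k (c0 k).
have [Y YP] : exists Y, forall k, (c k).2 <= Y <= (c k).2 + B k.
  by apply: (halving_limit b0) => k; have [] := cS k (c0 k).
have X0 : 0 < X by apply: lt_le_trans (c0 0%N) _; case/andP: (XP 0%N).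
have [be Fbe] := dF (z := Complex X Y) X0.
apply/eqP; rewrite -normr_le0; apply/ler_addgt0Pr => e e0; rewrite add0r.
(* The affine approximation bounds the integral by [2 * e' * (a + b)^2]; the
   summand 1 avoids a division by 0 when the rectangle is a point. *)
pose e' := e / (2 * (a + b) ^+ 2 + 1).
have D0 : 0 < 2 * (a + b) ^+ 2 + 1 by rewrite ltr_wpDl// mulr_ge0 ?exprn_ge0 ?addr_ge0.
have e'0 : 0 < e' by rewrite divr_gt0.
have [d d0 dle] := Fbe _ e'0.
have [k kd] : exists k, (a + b) / 2 ^+ k < d.
  have : (fun k => (a + b) * (2^-1) ^+ k) @ \oo --> (a + b) * 0.
    by apply: cvgMl_tmp; apply: cvg_expr; rewrite ger0_norm ?invf_lt1 ?ltr1n.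
  rewrite mulr0 => /cvgr0_norm_lt/(_ _ d0)[k _ /(_ k (leqnn k))] /= kd.
  by exists k; rewrite -exprVn (le_lt_trans (ler_norm _)).
have AB : A k + B k = (a + b) / 2 ^+ k by rewrite -mulrDl.
rewrite (le_trans (J k))//.
have F_near s t : (c k).1 <= s <= (c k).1 + A k -> (c k).2 <= t <= (c k).2 + B k ->
    nrm (Complex s t - Complex X Y) <= A k + B k.
  move=> /andP[s1 s2] /andP[t1 t2].
  have /andP[X1 X2] := XP k; have /andP[Y1 Y2] := YP k.
  rewrite (le_trans (nrm_le_ReIm _))//= lerD// ler_norml; apply/andP; split; lra.
have := @rect_int_affine_bound (Complex X Y) (F (Complex X Y)) be (c k).1 (c k).2
  (A k) (B k) (e' * (A k + B k)) (c0 k) (A0 k) (B0 k).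
have le_e s t : (c k).1 <= s <= (c k).1 + A k -> (c k).2 <= t <= (c k).2 + B k ->
    nrm (F (Complex s t) - F (Complex X Y) - be * (Complex s t - Complex X Y))
      <= e' * (A k + B k).
  move=> sk tk; have n1 := F_near _ _ sk tk.
  rewrite (le_trans (dle _ _))//; first by rewrite (le_lt_trans n1)// AB.
  by rewrite ler_wpM2l// ltW.
move=> /(_ le_e); rewrite AB => Jk.
rewrite (le_trans (ler_wpM2l (exprn_ge0 _ _) Jk))//.
have -> : 4 ^+ k * (2 * (e' * ((a + b) / 2 ^+ k)) * ((a + b) / 2 ^+ k)) =
    e' * (2 * (a + b) ^+ 2).
  have -> : (4 : R) = 2 * 2 by ring.
  rewrite exprMn; field; by rewrite expf_neq0.
by rewrite /e' mulrAC ler_pdivrMr// ler_wpM2l ?lerDl ?ltW.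
Qed.

End Goursat.

(** * The complex exponential *)

Section ComplexExponential.
Variable R : realType.
Local Notation C := (R[i]^o).

Lemma is_derive0_approx (f : R -> R) (a : R) : is_derive (0 : R) (1 : R) f a ->
  forall e, 0 < e -> exists2 d : R, 0 < d &
    forall x, `|x| < d -> `|f x - f 0 - a * x| <= e * `|x|.
Proof.
move=> df e e0; have /cvgrPdist_le/(_ _ e0) := @ex_derive _ _ _ _ _ _ _ df.
rewrite -/(derive _ _ _) derive_val near_withinE => /nbhs_ballP[d /= d0 dle].
exists d => // x xd; have [->|x0] := eqVneq x 0; first by rewrite !subrr mulr0 subrr normr0 mulr0.
have := dle x; rewrite /ball /= sub0r normrN => /(_ xd x0).
rewrite addr0 -[_ *: 1]/(x * 1) mulr1 -[_^-1 *: _]/(x^-1 * _).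
rewrite -(ler_pM2r (_ : 0 < `|x|)) ?normr_gt0// -normrM mulrBl.
by rewrite mulrAC mulVf// mul1r distrC.
Qed.

(** The expansions at [0] of the real exponential, of the sine and of the cosine,
    combined as [e^x cos y] and [e^x sin y]. *)
Lemma cexp_approx0 (e : R) : 0 < e -> exists2 d : R, 0 < d &
  forall h : C, nrm h < d -> nrm (cexp h - 1 - h) <= e * nrm h.
Proof.
move=> e0; pose e1 := Num.min 1 (e / 9).
have e10 : 0 < e1 by rewrite lt_min ltr01 divr_gt0.
have e11 : e1 <= 1 by rewrite ge_min lexx.
have e1e : 9 * e1 <= e by rewrite -ler_pdivlMl// mulrC ge_min lexx orbT.
have [d1 d10 H1] := is_derive0_approx (is_derive_expR (0 : R)) e10.
have [d2 d20 H2] := is_derive0_approx (is_derive_sin (0 : R)) e10.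
have [d3 d30 H3] := is_derive0_approx (is_derive_cos (0 : R)) e10.
exists (Num.min (Num.min d1 d2) (Num.min d3 e1)); first by rewrite lt_min lt_min d10 d20 /= lt_min d30 e10.
case=> x y; set h := Complex x y; rewrite !lt_min => /andP[/andP[h1 h2] /andP[h3 he]].
have xh : `|x| <= nrm h := Re_le_nrm h.
have yh : `|y| <= nrm h := Im_le_nrm h.
have {}H1 := H1 x (le_lt_trans xh h1).
have {}H2 := H2 y (le_lt_trans yh h2).
have {}H3 := H3 y (le_lt_trans yh h3).
rewrite expR0 mul1r in H1; rewrite sin0 cos0 mul1r subr0 in H2.
rewrite cos0 sin0 oppr0 mul0r subr0 in H3.
have h0 := nrm_ge0 h.
have x1 : `|x| <= 1 by lra.
have exE : expR x = (expR x - 1 - x) + (1 + x) by ring.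
have ex3 : `|expR x| <= 3.
  rewrite exE (le_trans (ler_normD _ _))// (le_trans (lerD H1 (ler_normD _ _)))//.
  rewrite normr1; have : e1 * `|x| <= 1 by rewrite mulr_ile1// ltW.
  lra.
have ex1 : `|expR x - 1| <= 2 * nrm h.
  have -> : expR x - 1 = (expR x - 1 - x) + x by ring.
  rewrite (le_trans (ler_normD _ _))//.
  have : e1 * `|x| <= `|x| by rewrite ler_piMl.
  lra.
rewrite (le_trans (nrm_le_ReIm _))// (_ : complex.Re _ =
  (expR x - 1 - x) + expR x * (cos y - 1)) 1?(_ : complex.Im _ =
  expR x * (sin y - y) + (expR x - 1) * y); first last.
- by rewrite /=; ring.
- by rewrite /=; ring.
have A1 : `|expR x - 1 - x| <= e1 * nrm h.
  by rewrite (le_trans H1)// ler_wpM2l// ltW.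
have A2 : `|expR x * (cos y - 1)| <= 3 * (e1 * nrm h).
  by rewrite normrM ler_pM// (le_trans H3)// ler_wpM2l// ltW.
have A3 : `|expR x * (sin y - y)| <= 3 * (e1 * nrm h).
  by rewrite normrM ler_pM// (le_trans H2)// ler_wpM2l// ltW.
have A4 : `|(expR x - 1) * y| <= 2 * (e1 * nrm h).
  rewrite normrM (le_trans (ler_pM _ _ ex1 yh))// -mulrA ler_wpM2l//.
  by rewrite ler_wpM2r// ltW// lt_min.
have e1h : 9 * (e1 * nrm h) <= e * nrm h by rewrite mulrA ler_wpM2r.
have B1 := ler_normD (expR x - 1 - x) (expR x * (cos y - 1)).
have B2 := ler_normD (expR x * (sin y - y)) ((expR x - 1) * y).
lra.
Qed.

Lemma nrm_cexp (z : C) : nrm (cexp z) = expR (complex.Re z).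
Proof. by rewrite /nrm norm_cexp. Qed.

Lemma cdiff_cexp_scale (l : R) (z : C) :
  cdiff (fun w : C => cexp (w * Complex l 0)) z.
Proof.
set L : C := Complex l 0; exists (cexp (z * L) * L) => e e0.
have K0 : 0 < nrm (cexp (z * L)) by rewrite nrm_cexp expR_gt0.
have l1 : 0 < `|l| + 1 by rewrite ltr_wpDl.
have [d d0 dle] := cexp_approx0 (divr_gt0 e0 (mulr_gt0 K0 l1)).
exists (d / (`|l| + 1)); first by rewrite divr_gt0.
move=> w wd; have -> : cexp (w * L) - cexp (z * L) - cexp (z * L) * L * (w - z) =
    cexp (z * L) * (cexp ((w - z) * L) - 1 - (w - z) * L).
  have -> : cexp (w * L) = cexp (z * L) * cexp ((w - z) * L).
    by rewrite -cexpD; congr cexp; ring.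
  by ring.
have wL : nrm ((w - z) * L) <= nrm (w - z) * (`|l| + 1).
  by rewrite nrmM nrm_real ler_wpM2l ?nrm_ge0// lerDl.
rewrite nrmM (le_trans (ler_wpM2l (ltW K0) (dle _ _)))//.
  by rewrite (le_lt_trans wL)// -ltr_pdivlMr.
set k := nrm (cexp _) in K0 *.
rewrite mulrA (_ : k * (e / (k * (`|l| + 1))) = e / (`|l| + 1)); last first.
  by field; rewrite !gt_eqF.
by rewrite -mulrA ler_pM2l// mulrC ler_pdivrMr.
Qed.

Lemma natcpowV n (s : C) : (natcpow n s)^-1 = cexp (s * Complex (- ln n%:R) 0).
Proof.
apply: (mulfI (natcpow_neq0 n s)); rewrite divff ?natcpow_neq0//.
rewrite /natcpow -cexpD -mulrDr (_ : _ + _ = 0) ?mulr0.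
  by rewrite /cexp /= expR0 cos0 sin0 mulr1 mulr0.
by rewrite -[LHS]/(Complex _ _) subrr addr0.
Qed.

Lemma nrm_natcpow n (s : C) : nrm (natcpow n s) = expR (complex.Re s * ln n%:R).
Proof. by rewrite /nrm norm_natcpow. Qed.

Lemma cdiff_natcpow n (s : C) : cdiff (natcpow n) s.
Proof. exact: cdiff_cexp_scale. Qed.

Lemma cdiff_natcpowV n (s : C) : cdiff (fun s => (natcpow n s)^-1) s.
Proof.
under [X in cdiff X _]funext do rewrite natcpowV.
exact: cdiff_cexp_scale.
Qed.

Lemma cdiffM (F G : C -> C) z : cdiff F z -> cdiff G z -> cdiff (fun w => F w * G w) z.
Proof.
move=> /derivable_cdiff dF /derivable_cdiff dG; apply/derivable_cdiff.
suff : derivable (F * G : C -> C) z 1 by [].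
by apply: (@derivableM R[i]); [exact: dF|exact: dG].
Qed.

Lemma cdiffZ (F : C -> C) (c : C) z : cdiff F z -> cdiff (fun w => c * F w) z.
Proof.
by move=> dF; apply: (@cdiffM (cst c)) => //; apply/derivable_cdiff; exact: derivable_cst.
Qed.

End ComplexExponential.

(** * Coefficients as mean values on vertical lines *)

Section MeanValue.
Variable R : realType.
Local Notation C := (R[i]^o).
Implicit Types (a : nat -> C).

(** Telescoping, as [1/(k+1)^3 <= 1/k - 1/(k+1)]. *)
Lemma dirichlet_tail a (s : C) (M : R) (l : C) : 0 <= M ->
  (forall m, (0 < m)%N -> nrm (a m / natcpow m s) <= M / m%:R ^+ 3) ->
  dirichlet_sum a s @ \oo --> l ->
  forall K, (0 < K)%N -> nrm (l - dirichlet_sum a s K) <= M / K%:R.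
Proof.
move=> M0 aM al K K0.
have part N : nrm (dirichlet_sum a s (K + N) - dirichlet_sum a s K) <=
    M / K%:R - M / (K + N)%:R.
  elim: N => [|N IH]; first by rewrite addn0 !subrr nrm0.
  rewrite addnS /dirichlet_sum big_nat_recr//= -addrA addrCA addrC.
  rewrite (le_trans (nrmD _ _))// (le_trans (lerD IH (aM _ _)))//.
  set k := (K + N)%N; have k0 : (0 < k)%N by rewrite addn_gt0 K0.
  have k0' : 0 < k%:R :> R by rewrite ltr0n.
  have kS : 0 < k.+1%:R :> R by rewrite ltr0n.
  have lin (u v w z : R) : v <= w - z -> u - w + v <= u - z by lra.
  apply: lin.
  rewrite -mulrBr ler_wpM2l//.
  have -> : k%:R^-1 - k.+1%:R^-1 = (k%:R * k.+1%:R)^-1 :> R.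
    by rewrite -natr1; field; rewrite natr1 !gt_eqF.
  rewrite lef_pV2 ?posrE ?exprn_gt0 ?mulr_gt0// !exprS expr0 mulr1.
  rewrite mulrC ler_pM2l// -natrM ler_nat; nia.
apply/ler_addgt0Pr => e e0.
have e0' : 0 < Complex e 0 :> C by rewrite (_ : 0 = Complex 0 0)// ltc_complexr.
have /cvgrPdist_le/(_ _ e0')[N _ /(_ (K + N)%N (leq_addl _ _))] /= := al.
rewrite ler_nrm => lN.
have -> : l - dirichlet_sum a s K = (l - dirichlet_sum a s (K + N)) +
    (dirichlet_sum a s (K + N) - dirichlet_sum a s K) by ring.
rewrite (le_trans (nrmD _ _))// addrC lerD// (le_trans (part N))//.
by rewrite gerBl divr_ge0.
Qed.

Lemma natcpow_ratio n m (x t : R) :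
  natcpow n (Complex x t) / natcpow m (Complex x t) =
  Complex (expR (x * (ln n%:R - ln m%:R)) * cos ((ln n%:R - ln m%:R) * t))
          (expR (x * (ln n%:R - ln m%:R)) * sin ((ln n%:R - ln m%:R) * t)).
Proof.
rewrite natcpowV /natcpow -cexpD /cexp /=.
by congr Complex; congr (expR _ * _); [ring|congr cos; ring|ring|congr sin; ring].
Qed.

Lemma is_derive_trig (k l A B t : R) : l != 0 ->
  is_derive t (1 : R) (fun t => k / l * (B * sin (l * t) - A * cos (l * t)))
    (k * (A * sin (l * t) + B * cos (l * t))).
Proof.
move=> l0; apply: is_derive_eq.
by rewrite /GRing.scale /=; field.
Qed.

(** [(n/m)^s] has a nonzero frequency on vertical lines, hence a bounded
    primitive. *)
Lemma oscillating_int (n m : nat) (c : C) (x : R) : (0 < n)%N -> (0 < m)%N -> m != n ->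
  exists B : R, forall T, 0 <= T -> `|seg_int (fun t => complex.Im
    (c * (natcpow n (Complex x t) / natcpow m (Complex x t)))) 0 T| <= B.
Proof.
move=> n0 m0 mn; pose l : R := ln n%:R - ln m%:R.
have l0 : l != 0.
  rewrite subr_eq0; apply: contra mn => /eqP /ln_inj; rewrite !posrE !ltr0n => /(_ n0 m0)/eqP.
  by rewrite eqr_nat eq_sym.
pose k := expR (x * l); case: c => a b.
pose g t := k / l * (b * sin (l * t) - a * cos (l * t)).
have gle t : `|g t| <= `|k / l| * (`|b| + `|a|).
  rewrite normrM ler_wpM2l// (le_trans (ler_normB _ _))// !normrM lerD//.
    by rewrite ler_piMr// ler_norml sin_geN1 sin_le1.
  by rewrite ler_piMr// ler_norml cos_geN1 cos_le1.
exists (`|k / l| * (`|b| + `|a|) + `|k / l| * (`|b| + `|a|)) => T T0.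
have -> : seg_int (fun t => complex.Im (Complex a b *
    (natcpow n (Complex x t) / natcpow m (Complex x t)))) 0 T = g T - g 0.
  rewrite -(@seg_int_derive R (fun t => k * (a * sin (l * t) + b * cos (l * t))) g 0 T
    T0 (fun t => is_derive_trig k a b t l0)).
  - by apply: eq_seg_int => t _; rewrite natcpow_ratio -/l -/k /=; ring.
  - move=> t; apply: cvgMl_tmp; apply: cvgD; apply: cvgMl_tmp.
      by apply: continuous_comp; [exact: mulrl_continuous|exact: continuous_sin].
    by apply: continuous_comp; [exact: mulrl_continuous|exact: continuous_cos].
by rewrite (le_trans (ler_normB _ _))// lerD.
Qed.

(** On the line of abscissa [x], where the series converges absolutely, [F(s) n^s]
    is the constant [a n], plus finitely many oscillating terms with bounded
    integrals, plus a uniformly small tail.  Dividing the integral over [0, T]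
    by [T] isolates [a n]. *)
Lemma mean_value_coef a (F : C -> C) (x M E E' : R) n : (0 < n)%N -> 0 <= M ->
  (forall t, cdiff F (Complex x t)) ->
  (forall t m, (0 < m)%N -> nrm (a m / natcpow m (Complex x t)) <= M / m%:R ^+ 3) ->
  (forall t, dirichlet_sum a (Complex x t) @ \oo --> F (Complex x t)) ->
  (forall T, 0 <= T -> `|seg_int (fun t => complex.Im
     (F (Complex x t) * natcpow n (Complex x t))) 0 T| <= E * T + E') ->
  `|complex.Im (a n)| <= E.
Proof.
move=> n0 M0 dF aM aF FE.
pose nx := expR (x * ln n%:R).
have nx0 : 0 < nx := expR_gt0 _.
pose S t := Complex x t : C.
have bound K : (n <= K)%N -> `|complex.Im (a n)| <= E + nx * (M / K%:R).
  move=> nK; have K0 : (0 < K)%N by rewrite (leq_trans n0).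
  pose h m t := complex.Im (a m * (natcpow n (S t) / natcpow m (S t))).
  have ch m T : cont_on (h m) 0 T.
    apply: (@cont_vertical_Im R (fun s => a m * (natcpow n s / natcpow m s))) => t.
    apply: cdiffZ; apply: cdiffM; [exact: cdiff_natcpow|exact: cdiff_natcpowV].
  have [B BP] : exists B : R, forall T, 0 <= T ->
      `|seg_int (fun t => \sum_(m <- rem n (index_iota 1 K.+1)) h m t) 0 T| <= B.
    have : all (fun m => (0 < m)%N && (m != n)) (rem n (index_iota 1 K.+1)).
      apply/allP => m; rewrite mem_rem_uniq ?iota_uniq// inE mem_index_iota.
      by move=> /and3P[-> -> _].
    elim: (rem _ _) => [_|m r IH /= /andP[/andP[m0 mn] /IH[B BP]]].
      exists 0 => T T0; under eq_fun do rewrite big_nil.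
      by rewrite seg_int_cst// mul0r normr0.
    have [B' BP'] := oscillating_int (a m) x n0 m0 mn.
    exists (B' + B) => T T0; under eq_fun do rewrite big_cons.
    rewrite seg_intD//; last by apply: cont_on_sum.
    by rewrite (le_trans (ler_normD _ _))// lerD// ?BP'// BP.
  pose H t := complex.Im (F (S t) * natcpow n (S t)).
  have cH T : cont_on H 0 T.
    apply: (@cont_vertical_Im R (fun s => F s * natcpow n s)) => t.
    by apply: cdiffM => //; exact: cdiff_natcpow.
  have key T : 0 <= T -> `|complex.Im (a n)| * T <= (E + nx * (M / K%:R)) * T + (E' + B).
    move=> T0.
    pose Q t := \sum_(m <- rem n (index_iota 1 K.+1)) h m t.
    have cQ : cont_on Q 0 T by apply: cont_on_sum.
    pose G t := H t - (complex.Im (a n) + Q t).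
    have cG : cont_on G 0 T.
      by apply: cont_onB => //; apply: cont_onD => //; exact: cont_on_cst.
    have Gle t : `|G t| <= nx * (M / K%:R).
      have -> : G t = complex.Im ((F (S t) - dirichlet_sum a (S t) K) * natcpow n (S t)).
        have hn : complex.Im (a n) = h n t.
          by rewrite /h divff ?natcpow_neq0// mulr1.
        have ImB (u v : C) : complex.Im (u - v) = complex.Im u - complex.Im v by exact: raddfB.
        have ImS (r : seq nat) (f : nat -> C) :
            complex.Im (\sum_(m <- r) f m) = \sum_(m <- r) complex.Im (f m).
          exact: raddf_sum.
        rewrite mulrBl ImB /G /H; congr (_ - _).
        rewrite mulr_suml ImS.
        rewrite [RHS](perm_big (n :: rem n (index_iota 1 K.+1))); last first.
          by apply: perm_to_rem; rewrite mem_index_iota n0.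
        rewrite big_cons hn; congr (_ + _).
          by rewrite /h mulrAC mulrA.
        by apply: eq_bigr => m _; rewrite /h mulrAC mulrA.
      rewrite (le_trans (Im_le_nrm _))// nrmM nrm_natcpow /= -/nx mulrC ler_pM2l//.
      by apply: (dirichlet_tail M0 (aM t) (aF t)).
    have eqT : complex.Im (a n) * T = seg_int H 0 T - seg_int G 0 T - seg_int Q 0 T.
      have -> : seg_int G 0 T = seg_int H 0 T - (complex.Im (a n) * T + seg_int Q 0 T).
        rewrite seg_intB//; last by apply: cont_onD => //; exact: cont_on_cst.
        rewrite seg_intD//; last exact: cont_on_cst.
        by rewrite seg_int_cst// subr0.
      by ring.
    rewrite -{1}(ger0_norm T0) -normrM eqT.
    have G1 := @seg_int_bound R G 0 T _ T0 cG (fun t _ => Gle t).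
    rewrite subr0 in G1.
    have := FE T T0; have := BP T T0; rewrite -/(Q) -/H => Q1 H1.
    rewrite (le_trans (ler_normB _ _))// (le_trans (lerD (ler_normB _ _) (lexx _)))//.
    have : `|seg_int H 0 T| + `|seg_int G 0 T| + `|seg_int Q 0 T| <=
       (E * T + E') + nx * (M / K%:R) * T + B by rewrite !lerD.
    by move=> /le_trans; apply; lra.
  apply/ler_addgt0Pr => e e0.
  pose T := (`|E' + B| + 1) / e.
  have T0 : 0 < T by rewrite divr_gt0// ltr_wpDl.
  rewrite -(ler_pM2r T0) (le_trans (key T (ltW T0)))// [leRHS]mulrDl lerD2l.
  by rewrite /T mulrC divfK ?gt_eqF// (le_trans (ler_norm _))// lerDl.
apply/ler_addgt0Pr => e e0.
have : (fun K => nx * M * harmonic K) @ \oo --> (nx * M * 0 : R).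
  by apply: cvgMl_tmp; exact: cvg_harmonic.
rewrite mulr0 => /cvgr0_norm_le/(_ _ e0)[K _ /(_ (n + K)%N (leq_addl _ _))] /= Ke.
rewrite (le_trans (bound (n + K).+1 _))//; first by rewrite -addnS leq_addr.
by rewrite lerD2l (le_trans _ Ke)// (le_trans _ (ler_norm _))// mulrA.
Qed.

End MeanValue.

(** * Bounded Dirichlet series and their coefficients *)

Section Coefficients.
Variable R : realType.
Local Notation C := (R[i]^o).
Implicit Types (f g : @halfplane R -> C) (a b : nat -> C).

Definition represents f a := exists x0 : R, forall s : @halfplane R,
  x0 < complex.Re (val s) -> dirichlet_sum a (val s) @ \oo --> (f s : C).

(** The extension by zero outside the half-plane. *)
Definition ext0 f : C -> C := 'valL_(0 : C) f.

Lemma ext0E f (s : @halfplane R) : ext0 f (val s) = f s.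
Proof. exact: (congr1 (fun F => F s) (valLK (0 : C) f)). Qed.

Definition hp (s : C) (s0 : halfplane s) : @halfplane R := SigSub (mem_set s0).

(** Convergence at one point bounds the terms there, hence gives absolute
    convergence three units further to the right. *)
Lemma represents_far f a : represents f a -> exists x0 K : R, [/\ 1 <= x0, 0 <= K &
  forall s : C, x0 <= complex.Re s ->
    (forall m, (0 < m)%N -> nrm (a m / natcpow m s) <= K / m%:R ^+ 3) /\
    dirichlet_sum a s @ \oo --> ext0 f s].
Proof.
move=> [x1 fa]; pose t : R := Num.max 0 x1 + 1.
have tx1 : x1 < t by rewrite ltr_pwDr// le_max lexx orbT.
have t1 : 1 <= t by rewrite lerDr le_max lexx.
have t0 : halfplane (Complex t 0 : C) by rewrite /halfplane /= (lt_le_trans ltr01).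
have [K K0 aK] := dirichlet_term_bounded (fa (hp t0) tx1).
exists (t + 3), K; split=> // [|s st]; first by lra.
split=> [m m0|].
  by rewrite -ler_nrm; apply: dirichlet_term_decay (aK m m0) _.
have s0 : halfplane s by rewrite /halfplane /=; lra.
rewrite -[s]/(val (hp s0)) ext0E; apply: fa => /=.
by rewrite (lt_le_trans tx1)// (le_trans _ st)// lerDl.
Qed.

Lemma representsZ (c : C) f a : represents f a ->
  represents (fun s => c * f s) (fun n => c * a n).
Proof.
move=> [x0 fa]; exists x0 => s sx; have := fa s sx.
have -> : dirichlet_sum (fun n => c * a n) (val s) =
    (fun N => c * dirichlet_sum a (val s) N).
  by apply/funext => N; rewrite mulr_sumr; apply: eq_bigr => n _; rewrite mulrA.
by move=> H; apply: (@cvgMl_tmp R[i]).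
Qed.

Lemma representsB f g a b : represents f a -> represents g b ->
  represents (f - g) (a - b).
Proof.
move=> [x fa] [y gb]; exists (Num.max x y) => s; rewrite gt_max => /andP[xs ys].
have -> : dirichlet_sum (a - b) (val s) =
    (fun N => dirichlet_sum a (val s) N - dirichlet_sum b (val s) N).
  by apply/funext => N; rewrite /dirichlet_sum -sumrB; apply: eq_bigr => n _;
    rewrite -mulrBl.
by apply: cvgB; [exact: fa|exact: gb].
Qed.

Lemma representsM f g a b : represents f a -> represents g b ->
  represents (f * g) (dirichlet_conv a b).
Proof.
move=> /represents_far[x [K [x1 K0 fa]]] /represents_far[y [L [y1 L0 gb]]].
exists (Num.max x y) => s; rewrite gt_max => /andP[xs ys].
have [aK fs] := fa (val s) (ltW xs); have [bL gs] := gb (val s) (ltW ys).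
rewrite ext0E in fs; rewrite ext0E in gs.
apply: (cvg_dirichlet_conv K0 L0) => // n n0; rewrite ler_nrm; [exact: aK|exact: bL].
Qed.

Lemma eq_represents f a b : (forall n, (0 < n)%N -> a n = b n) ->
  represents f a -> represents f b.
Proof.
move=> ab [x fa]; exists x => s xs.
rewrite (_ : dirichlet_sum b _ = dirichlet_sum a (val s)); first exact: fa.
by apply/funext => N; apply: eq_big_nat => n /andP[n0 _]; rewrite ab.
Qed.

Lemma represents_unit_seq k : (0 < k)%N ->
  represents (fun s => (natcpow k (val s))^-1) (unit_seq R k).
Proof.
move=> k0; exists 0 => s _; apply: cvg_near_cst; exists k => // N /= kN.
rewrite /dirichlet_sum (bigD1_seq k) ?iota_uniq//=; last first.
  by rewrite mem_index_iota k0 ltnS.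
rewrite /unit_seq eqxx mul1r big1 ?addr0// => n /negPf ->.
by rewrite mul0r.
Qed.

Lemma Im_mul_i (z : C) : complex.Im (Complex 0 1 * z) = complex.Re z.
Proof. by case: z => x y /=; rewrite mul0r mul1r add0r. Qed.

Lemma nrm_i : nrm (Complex 0 1 : C) = 1.
Proof. by rewrite nrmE /= expr0n add0r expr1n sqrtr1. Qed.

Lemma represents0_Im a : represents 0 a -> forall n, (0 < n)%N -> complex.Im (a n) = 0.
Proof.
move=> /represents_far[x [K [x1 K0 aP]]] n n0; apply/eqP; rewrite -normr_le0.
have ext00 t : ext0 0 (Complex x t) = 0.
  have s0 : halfplane (Complex x t : C) by rewrite /halfplane /= (lt_le_trans ltr01).
  by rewrite -[Complex x t]/(val (hp s0)) ext0E.
apply: (@mean_value_coef R a (fun=> 0) x K 0 0 n n0 K0).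
- by move=> t; apply/derivable_cdiff; exact: derivable_cst.
- by move=> t; have [] := aP (Complex x t) (lexx x).
- by move=> t; have [_] := aP (Complex x t) (lexx x); rewrite ext00.
- move=> T T0; rewrite mul0r addr0.
  under eq_fun do rewrite mul0r.
  by rewrite seg_int_cst// mul0r normr0.
Qed.

Lemma represents_uniq f a b : represents f a -> represents f b ->
  forall n, (0 < n)%N -> a n = b n.
Proof.
move=> fa fb n n0; have := representsB fa fb; rewrite subrr => ab0.
have I0 := represents0_Im ab0 n0.
have : represents 0 (fun n => Complex 0 1 * (a - b) n : C).
  rewrite (_ : 0 = fun s => Complex 0 1 * (0 : @halfplane R -> C) s); first exact: representsZ.
  by apply/funext => s; rewrite [RHS]mulr0.
move=> /represents0_Im/(_ n n0); rewrite Im_mul_i => R0.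
by apply/eqP; rewrite -subr_eq0 eq_complex; apply/andP; split; apply/eqP.
Qed.

(** [f(s) n^s] is bounded by [M n] on the line of abscissa [1].  Its integrals over
    [0, T] on that line and on a far line differ by integrals over two
    horizontal segments, which are bounded independently of [T]; so the mean
    value on the far line, which is [a n], has the same bound. *)
Lemma represents_Im_le f a (M : R) : holomorphic_halfplane f ->
  (forall s, nrm (f s) <= M) -> represents f a ->
  forall n, (0 < n)%N -> `|complex.Im (a n)| <= M * n%:R.
Proof.
move=> df fM /represents_far[x [K [x1 K0 aP]]] n n0.
have dF (z : C) : 0 < complex.Re z -> cdiff (ext0 f) z.
  by move=> z0; apply/derivable_cdiff; exact: df.
pose G s := ext0 f s * natcpow n s.
have dG (z : C) : 0 < complex.Re z -> cdiff G z.
  by move=> z0; apply: cdiffM; [exact: dF|exact: cdiff_natcpow].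
have GM (z : C) : 0 < complex.Re z -> nrm (G z) <= M * expR (complex.Re z * ln n%:R).
  move=> z0; rewrite nrmM nrm_natcpow ler_wpM2r ?expR_ge0//.
  by rewrite -[z]/(val (hp z0)) ext0E.
have x0 : 0 < x by exact: lt_le_trans x1.
have M0 : 0 <= M by rewrite (le_trans (nrm_ge0 _) (fM (hp (x0 : halfplane (Complex x 0))))).
have ln0 : 0 <= ln n%:R :> R by rewrite ln_ge0// ler1n.
have n1 : expR (1 * ln n%:R) = n%:R :> R by rewrite mul1r lnK// posrE ltr0n.
pose E' := 2 * (M * expR (x * ln n%:R)) * (x - 1).
apply: (@mean_value_coef R a (ext0 f) x K _ E' n n0 K0).
- by move=> t; exact: dF.
- by move=> t; have [] := aP (Complex x t) (lexx x).
- by move=> t; have [] := aP (Complex x t) (lexx x).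
move=> T T0; rewrite -[fun t => _]/(fun t => complex.Im (G (Complex x t))).
have x10 : 0 <= x - 1 by rewrite subr_ge0.
have := goursat_rectangle dG 0 ltr01 x10 T0.
have xE : 1 + (x - 1) = x by ring.
rewrite /rect_int !add0r xE => /eqP; rewrite subr_eq0 => /eqP H.
have cI y : 0 < y -> cont_on (fun t => complex.Im (G (Complex y t))) 0 T.
  by move=> y0; apply: cont_vertical_Im => t; exact: dG.
have cR y : cont_on (fun t => complex.Re (G (Complex t y))) 1 x.
  by apply: cont_horizontal_Re => t /andP[t1 _]; apply: dG; exact: lt_le_trans t1.
move: H; rewrite (seg_intB (cI x x0) (cI 1 ltr01)).
set I1 := seg_int _ 0 T; set I2 := seg_int _ 0 T; set I3 := seg_int _ 1 x => H.
have -> : I1 = I2 + I3 by rewrite H; ring.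
rewrite (le_trans (ler_normD _ _))// lerD//.
  rewrite -[X in _ * X]subr0; apply: seg_int_bound => //; first exact: cI.
  move=> t _; rewrite (le_trans (Im_le_nrm _))// (le_trans (GM _ _))//=.
  by rewrite n1.
apply: seg_int_bound => //; first exact: cont_onB.
move=> t /andP[t1 tx].
have Gt y : `|complex.Re (G (Complex t y))| <= M * expR (x * ln n%:R).
  rewrite (le_trans (Re_le_nrm _))// (le_trans (GM _ _))//=.
    exact: lt_le_trans t1.
  by rewrite ler_wpM2l// ler_expR ler_wpM2r.
by rewrite (le_trans (ler_normB _ _))// mulr_natl mulr2n lerD.
Qed.

(** The real part of [a n] is the imaginary part of the coefficient of [i f]. *)
Lemma represents_nrm_le f a (M : R) : holomorphic_halfplane f ->
  (forall s, nrm (f s) <= M) -> represents f a ->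
  forall n, (0 < n)%N -> nrm (a n) <= 2 * M * n%:R.
Proof.
move=> df fM fa n n0; have Im1 := represents_Im_le df fM fa n0.
pose f' : @halfplane R -> C := fun s => Complex 0 1 * f s.
have df' : holomorphic_halfplane f'.
  move=> s s0; apply/derivable_cdiff; rewrite -/(ext0 f').
  have -> : ext0 f' = (fun w => Complex 0 1 * ext0 f w).
    apply/funext => w; rewrite /ext0 /f' /=; case: ('oinv_set_val w) => //=.
    by rewrite mulr0.
  by apply: cdiffZ; apply/derivable_cdiff; exact: df.
have f'M s : nrm (f' s) <= M by rewrite nrmM nrm_i mul1r.
have := represents_Im_le df' f'M (representsZ (Complex 0 1) fa) n0.
rewrite Im_mul_i => Re1.
by rewrite (le_trans (nrm_le_ReIm _))// mulr_natl mulr2n mulrDl lerD.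
Qed.

Lemma sum_wt2_le N : \sum_(1 <= n < N.+1) wt 2 n <= 2 :> R.
Proof.
have w2 n : (0 < n)%N -> wt 2 n = (n%:R ^+ 2)^-1 :> R.
  by move=> n0; rewrite /wt expRN expRM_natl lnK// posrE ltr0n.
suff : \sum_(1 <= n < N.+2) wt 2 n <= 2 - N.+1%:R^-1 :> R.
  move=> H; rewrite (le_trans _ (le_trans H _))//; last by rewrite gerBl invr_ge0.
  by rewrite [leRHS]big_nat_recr//= lerDl wt_ge0.
elim: N => [|N IH]; first by rewrite big_nat1 w2// expr1n invr1; lra.
rewrite big_nat_recr//= w2//.
have k0 : 0 < N.+1%:R :> R by rewrite ltr0n.
have kE : N.+2%:R = N.+1%:R + 1 :> R by rewrite -natr1.
rewrite kE; move: IH k0; set S := \sum_(_ <= _ < _) _.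
move: (N.+1%:R : R) => k IH k0.
rewrite (le_trans (lerD IH (lexx _)))// -subr_ge0.
have -> : 2 - (k + 1)^-1 - (2 - k^-1 + (k + 1) ^- 2) = (k * (k + 1) ^+ 2)^-1.
  by field; rewrite !gt_eqF// ltr_wpDr// ltW.
by rewrite invr_ge0 mulr_ge0 ?exprn_ge0 ?addr_ge0 ?ltW.
Qed.

(** The coefficients grow at most linearly, so they are summable with weight
    [n^-3], whatever the half-plane of convergence. *)
Lemma Hinfty_dseries (f : HinftyType R) : exists a : dseries R, represents f a.
Proof.
have /asboolP[df /bounded_halfplaneP[M fM] [a [x fa]]] := HinftyP f.
have repr : represents f a by exists x.
pose M' := nrm M.
have fM' s : nrm (f s) <= M'.
  rewrite -ler_nrm -normE (le_trans (fM s))//.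
  by rewrite real_ler_norm// ger0_real// (le_trans _ (fM s)).
pose a' n := if n is 0%N then 0 else a n.
have a'P : a' \in @summable_below4 R.
  apply/asboolP; split=> //; exists 3, (2 * M' * 2).
  split=> [|N]; first by rewrite ltr_nat.
  apply: le_trans (ler_wpM2l _ (sum_wt2_le N)); last by rewrite mulr_ge0 ?nrm_ge0.
  rewrite mulr_sumr /wsum big_nat [leRHS]big_nat; apply: ler_sum => n /andP[n0 _].
  have -> : wt 2 n = n%:R * wt 3 n :> R.
    rewrite -[n%:R in RHS](@lnK R) ?posrE ?ltr0n// /wt -expRD; congr expR.
    by ring.
  rewrite mulrA ler_wpM2r ?wt_ge0//; case: n n0 => // n _.
  exact: (represents_nrm_le df fM' repr).
exists (DSeries a'P); apply: eq_represents repr.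
by case.
Qed.

Definition coef (f : HinftyType R) : dseries R := sval (cid (Hinfty_dseries f)).

Lemma coefP (f : HinftyType R) : represents f (coef f).
Proof. exact: (svalP (cid (Hinfty_dseries f))). Qed.

Lemma coef_eq (f : HinftyType R) (a : dseries R) : represents f a -> coef f = a.
Proof.
by move=> fa; apply: dseries_eqP; apply: represents_uniq fa; exact: coefP.
Qed.

Lemma coef_zmod_morphism : zmod_morphism coef.
Proof. by move=> f g; apply: coef_eq; apply: representsB; exact: coefP. Qed.

Lemma coef_monoid_morphism : monoid_morphism coef.
Proof.
split=> [|f g]; last by apply: coef_eq; apply: representsM; exact: coefP.
apply: coef_eq; have := represents_unit_seq (ltn0Sn 0).
rewrite (_ : (fun s => _) = (1 : HinftyType R))//.
by apply/funext => s; rewrite natcpow1 invr1.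
Qed.

HB.instance Definition _ :=
  GRing.isZmodMorphism.Build (HinftyType R) (dseries R) coef coef_zmod_morphism.
HB.instance Definition _ :=
  GRing.isMonoidMorphism.Build (HinftyType R) (dseries R) coef coef_monoid_morphism.

End Coefficients.

(** * The unimodular rows that are not reducible *)

Section DirichletMonomials.
Variable R : realType.
Local Notation C := (R[i]^o).

Lemma holomorphic_halfplane_val (F : C -> C) :
  (forall z, halfplane z -> derivable F z 1) ->
  holomorphic_halfplane (fun s : @halfplane R => F (val s)).
Proof.
move=> dF s s0; apply: (@near_eq_derivable R[i] C C F); last exact: dF.
apply: filterS (halfplane_nbhs s0) => w w0; symmetry.
exact: (ext0E (fun s : @halfplane R => F (val s)) (hp w0)).
Qed.

Lemma represents_cst (c : C) : represents (fun=> c) (dcst c).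
Proof.
exists 0 => s _; apply: cvg_near_cst; exists 1%N => // N /= N1.
rewrite /dirichlet_sum big_ltn// eqxx natcpow1 divr1 big1_seq ?addr0// => n /=.
by rewrite mem_index_iota => /andP[n1 _]; rewrite gtn_eqF// mul0r.
Qed.

Lemma Hinfty_natcpowV k : (fun s : @halfplane R => (natcpow k.+1 (val s))^-1) \in @Hinfty R.
Proof.
apply/asboolP; split.
- apply: (holomorphic_halfplane_val (F := fun s => (natcpow k.+1 s)^-1)) => z _.
  by apply/derivable_cdiff; exact: cdiff_natcpowV.
- apply/bounded_halfplaneP; exists (Complex 1 0) => s.
  rewrite ler_nrm nrmV nrm_natcpow -expRN -[leRHS]expR0 ler_expR oppr_le0 mulr_ge0 ?ln_ge0 ?ler1n//.
  by apply: ltW; exact: (set_mem (valP s)).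
- by have [x H] := @represents_unit_seq R k.+1 isT; exists (unit_seq R k.+1), x.
Qed.

Lemma Hinfty_cst (c : C) : (fun=> c) \in @Hinfty R.
Proof.
apply/asboolP; split.
- by apply: (holomorphic_halfplane_val (F := cst c)) => z _; exact: derivable_cst.
- by apply/bounded_halfplaneP; exists `|c|.
- by have [x H] := represents_cst c; exists (dcst c), x.
Qed.

(** The monomial [k^-s], with [0] read as [1], as in [dunit]. *)
Definition hexp k : HinftyType R := HinftyElt (Hinfty_natcpowV k.-1).
Definition hcst (c : C) : HinftyType R := HinftyElt (Hinfty_cst c).

Lemma coef_hexp k : coef (hexp k) = dunit R k.
Proof. by apply: coef_eq; exact: represents_unit_seq. Qed.

Lemma coef_hcst c : coef (hcst c) = dcst c.
Proof. by apply: coef_eq; exact: represents_cst. Qed.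

Lemma hcstM (c e : C) : hcst c * hcst e = hcst (c * e).
Proof. by apply/val_inj. Qed.

Lemma hcst1 : hcst 1 = 1.
Proof. by apply/val_inj. Qed.

End DirichletMonomials.

Fixpoint prime_seq k : nat := if k is k'.+1 then s2val (prime_above (prime_seq k')) else 2.

Lemma prime_seq_prime k : prime (prime_seq k).
Proof. by case: k => //= k; case: prime_above. Qed.

Lemma prime_seq_inj : injective prime_seq.
Proof.
have mono : {homo prime_seq : i j / (i < j)%N}.
  by apply: homo_ltn => [|k]; [exact: ltn_trans|rewrite /=; case: prime_above].
move=> i j ij; apply/eqP; case: ltngtP => // /mono; by rewrite ij ltnn.
Qed.

(** The row is [(z_1, ..., z_n, g)] with [z_j], [w_j] and [g] attached to the first
    [2n] primes.  A reduction of it, read on coefficients, contradicts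
    [dseries_no_unimodular_perturbation]. *)
Lemma not_unimodular_reducible (R : realType) n : ~ unimodular_reducible (HinftyType R) n.
Proof.
pose P (i : 'I_(n + n)) := prime_seq i.
have P_prime i : prime (P i) by exact: prime_seq_prime.
have P_inj : injective P by move=> i j /prime_seq_inj /val_inj.
pose c : R[i]^o := Complex (radius2 R P) 0.
have c0 : c != 0 by rewrite eq_complex /= eqxx andbT gt_eqF// wt_gt0.
pose z j := hexp R (P (lshift n j)).
pose w j := hexp R (P (rshift n j)).
pose g := hcst c - \sum_j z j * w j.
pose a (i : 'I_n.+1) := oapp z g (unlift ord_max i).
have widenE (j : 'I_n) : widen_ord (leqnSn n) j = lift ord_max j.
  by apply/val_inj; rewrite /= /bump leqNgt ltn_ord.
have az j : a (widen_ord (leqnSn n) j) = z j by rewrite /a widenE liftK.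
have ag : a ord_max = g by rewrite /a unlift_none.
move=> /(_ a); case.
  exists (fun i => oapp (fun j => hcst c^-1 * w j) (hcst c^-1) (unlift ord_max i)).
  rewrite big_ord_recr /= unlift_none ag.
  under eq_bigr do rewrite az widenE liftK /= -mulrA (mulrC (w _)).
  by rewrite -mulr_sumr -mulrDr addrC subrK hcstM mulVf ?hcst1.
move=> x [b /(congr1 (@coef R))]; rewrite rmorph_sum rmorph1 => bx.
apply: (@dseries_no_unimodular_perturbation R n P (@coef R \o x) (@coef R \o b)
  P_prime P_inj).
rewrite -[RHS]bx; apply: eq_bigr => j _.
rewrite az ag rmorphM rmorphD rmorphM /= coef_hexp; congr (_ * (_ + _ * _)).
rewrite /g raddfB raddf_sum /= coef_hcst; congr (_ - _).
by apply: eq_bigr => i _; rewrite rmorphM /= !coef_hexp.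
Qed.

Theorem theorem1p6 (R : realType) : bass_stable_rank (HinftyType R) = None.
Proof.
apply/bass_stable_rank_infiniteP => n _; exact: not_unimodular_reducible.
Qed.
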